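(* Let $K$ be an algebraically closed field of characteristic $0$, let $H$ be a finite-dimensional Hopf $K$-algebra, and let $H_0\subseteq H_1\subseteq\cdots\subseteq H_n\subseteq\cdots$ be a Hopf algebra filtration of $H$, with $H=\bigcup_{n\ge 0}H_n$ and $\Delta(H_n)\subseteq\sum_{m=0}^{n}H_m\otimes H_{n-m}$ for all $n\ge 0$. Then the associated graded Hopf algebra $gr(H)=\bigoplus_{n\geq 0}H_n/H_{n-1}$ (with $H_{-1}=0$) is a degeneration of $H$.
   Context: A Hopf algebra filtration of $H$ is an increasing family of subspaces $(H_n)_{n\ge0}$ with $1\in H_0$, $H_iH_j\subseteq H_{i+j}$, $\Delta(H_n)\subseteq\sum_{m=0}^n H_m\otimes H_{n-m}$ and $S(H_n)\subseteq H_n$; then $gr(H)$ carries the induced graded Hopf algebra structure. Variety of Hopf algebras: let $V$ be a $d$-dimensional $K$-vector space with basis $e_1,\dots,e_d$. $Hopf_d$ is the set of triples $(\mu,\Delta,\varepsilon)$, $\mu:V\otimes V\to V$, $\Delta:V\to V\otimes V$, $\varepsilon:V\to K$, which together with the unit $e_1$ make $V$ a Hopf algebra (a bialgebra possessing an antipode). Via structure constants ($\mu(e_i\otimes e_j)=\sum_k C_{ij}^ke_k$, $\Delta(e_i)=\sum_{j,k}D_i^{jk}e_j\otimes e_k$, $\varepsilon(e_i)=\xi_i$) it is a subset of $K^{2d^3+d}$ and is given the Zariski topology. A $d$-dimensional Hopf algebra is regarded as a point of $Hopf_d$ by choosing a basis whose first element is the unit. A linear automorphism $f$ of $V$ acts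 by $f\cdot\mu=f^{-1}\circ\mu\circ(f\otimes f)$, $f\cdot\Delta=(f^{-1}\otimes f^{-1})\circ\Delta\circ f$, $f\cdot\varepsilon=\varepsilon\circ f$. The orbit $\vartheta(H)$ is the set of points of $Hopf_d$ of the form $f\cdot H$, i.e. the set of structures isomorphic to $H$. Degeneration: for Hopf algebras $H_0,H$ of the same dimension $d$, $H_0$ is a degeneration of $H$ if $H_0$ lies in the Zariski closure $\overline{\vartheta(H)}$ of the orbit of $H$. *)

(* Defs.v *)
From HB Require Import structures.
From mathcomp Require Import all_boot all_order all_algebra.
From mathcomp Require Import zify.
From mathcomp Require Import mpoly.

Set Implicit Arguments.
Unset Strict Implicit.
Unset Printing Implicit Defensive.

Import GRing.Theory.

Local Open Scope ring_scope.
Local Open Scope quotient_scope.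

(* Tensor products.  U (x) W is modelled by the matrices of coefficients with *)
(* respect to the bases vbasis {:U} and vbasis {:W}; tlift gives the          *)
(* universal property (tliftE).                                               *)

Section Tensor.
Variable K : fieldType.
Implicit Types U W Z : vectType K.

Definition tprod U W : vectType K := 'M[K]_(\dim {:U}, \dim {:W}).

Definition tens U W (u : U) (w : W) : tprod U W :=
  \matrix_(i, j) (coord (vbasis {:U}) i u * coord (vbasis {:W}) j w).

Definition tlift_fun U W Z (f : U -> W -> Z) (t : tprod U W) : Z :=
  \sum_i \sum_j t i j *: f (vbasis {:U})`_i (vbasis {:W})`_j.

Definition tlift U W Z (f : U -> W -> Z) : 'Hom(tprod U W, Z) :=
  linfun (tlift_fun f).

Lemma tlift_fun_linear U W Z (f : U -> W -> Z) : linear (tlift_fun f).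
Proof.
move=> a s t; rewrite /tlift_fun scaler_sumr -big_split /=.
apply: eq_bigr => i _; rewrite scaler_sumr -big_split /=.
by apply: eq_bigr => j _; rewrite !mxE scalerA scalerDl.
Qed.

Lemma tliftE U W Z (f : U -> W -> Z) (u : U) (w : W) :
    (forall x, linear (f x)) -> (forall y, linear (f^~ y)) ->
  tlift f (tens u w) = f u w.
Proof.
move=> fr fl.
pose g : {linear tprod U W -> Z} :=
  HB.pack (tlift_fun f) (GRing.isLinear.Build K _ _ _ _ (tlift_fun_linear f)).
rewrite /tlift -[tlift_fun f]/(g : _ -> _) lfunE /= /tlift_fun.
pose h1 y : {linear U -> Z} := HB.pack (f^~ y) (GRing.isLinear.Build K _ _ _ _ (fl y)).
pose h2 x : {linear W -> Z} := HB.pack (f x) (GRing.isLinear.Build K _ _ _ _ (fr x)).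
rewrite {2}(coord_vbasis (memvf u)) -[f _ w]/(h1 w _) linear_sum /=.
apply: eq_bigr => i _; rewrite -[f _ w]/(h1 w _) linearZ /=.
rewrite -[f _ w]/(h2 (vbasis {:U})`_i _) {2}(coord_vbasis (memvf w)).
rewrite linear_sum scaler_sumr; apply: eq_bigr => j _.
by rewrite linearZ /= scalerA mxE.
Qed.

Definition tmap U W U' W' (f : 'Hom(U, U')) (g : 'Hom(W, W')) :
    'Hom(tprod U W, tprod U' W') :=
  tlift (fun u w => tens (f u) (g w)).

Definition tassoc U V W :
    'Hom(tprod (tprod U V) W, tprod U (tprod V W)) :=
  tlift (fun s w => tlift (fun u v => tens u (tens v w)) s).

Definition tsub U W (A : {vspace U}) (B : {vspace W}) : {vspace tprod U W} :=
  <<[seq tens u w | u <- vbasis A, w <- vbasis B]>>%VS.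

End Tensor.

Notation "u ⊗ w" := (tens u w) (at level 40, left associativity).

Section Hopf.
Variable K : fieldType.

Record hopf_ops (V : vectType K) := HopfOps {
  mu : 'Hom(tprod V V, V);
  Delta : 'Hom(V, tprod V V);
  eps : 'Hom(V, K^o)
}.

Record hopf_data := HopfData {
  hsort :> vectType K;
  hone : hsort;
  hops : hopf_ops hsort
}.

Section HopfStructure.
Variable H : hopf_data.
Implicit Types x y z : H.

Definition hmul x y : H := mu (hops H) (x ⊗ y).
Definition hDelta : 'Hom(H, tprod H H) := Delta (hops H).
Definition heps x : K := eps (hops H) x.

(* (a (x) b) (c (x) d) = ac (x) bd *)
Definition tmul (s t : tprod H H) : tprod H H :=
  tlift (fun a b => tlift (fun c d => hmul a c ⊗ hmul b d) t) s.

Record bialgebra : Prop := Bialgebra {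
  hmulA : forall x y z, hmul x (hmul y z) = hmul (hmul x y) z;
  hmul1x : forall x, hmul (hone H) x = x;
  hmulx1 : forall x, hmul x (hone H) = x;
  hDeltaA : forall x, tassoc H H H (tmap hDelta \1 (hDelta x)) =
                      tmap \1 hDelta (hDelta x);
  heps_l : forall x, tlift (fun a b => heps a *: b) (hDelta x) = x;
  heps_r : forall x, tlift (fun a b => heps b *: a) (hDelta x) = x;
  hDeltaM : forall x y, hDelta (hmul x y) = tmul (hDelta x) (hDelta y);
  hDelta1 : hDelta (hone H) = hone H ⊗ hone H;
  hepsM : forall x y, heps (hmul x y) = heps x * heps y;
  heps1 : heps (hone H) = 1
}.

Record antipode (S : 'End(H)) : Prop := Antipode {
  antipode_l :
    forall x, tlift (fun a b => hmul (S a) b) (hDelta x) = heps x *: hone H;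
  antipode_r :
    forall x, tlift (fun a b => hmul a (S b)) (hDelta x) = heps x *: hone H
}.

Definition hopf_algebra : Prop := bialgebra /\ exists S, antipode S.

Record hopf_filtration (S : 'End(H)) (F : nat -> {vspace H}) : Prop :=
  HopfFiltration {
  filt_incr : forall n, (F n <= F n.+1)%VS;
  filt_one : hone H \in F 0%N;
  filt_mul :
    forall i j x y, x \in F i -> y \in F j -> hmul x y \in F (i + j)%N;
  filt_Delta :
    forall n, (hDelta @: F n <= \sum_(m < n.+1) tsub (F m) (F (n - m)%N))%VS;
  filt_S : forall n, (S @: F n <= F n)%VS
}.

Definition exhaustive (F : nat -> {vspace H}) : Prop :=
  forall x : H, exists n, x \in F n.

Lemma filt_full S F :
  hopf_filtration S F -> exhaustive F -> exists N, F N == fullv.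
Proof.
move=> hF exF.
have Fle m n : (m <= n)%N -> (F m <= F n)%VS.
  elim: n => [|n IHn]; first by rewrite leqn0 => /eqP->.
  rewrite leq_eqVlt ltnS => /predU1P[-> //|/IHn/subv_trans]; apply.
  exact: filt_incr hF n.
have [N FN] : exists N, {subset (vbasis {:H} : seq H) <= F N}.
  elim: (vbasis {:H} : seq H) => [|x s [N IHs]]; first by exists 0%N.
  have [n Fx] := exF x; exists (maxn n N) => y; rewrite inE => /predU1P[->|sy].
    exact: subvP (Fle _ _ (leq_maxl n N)) _ Fx.
  exact: subvP (Fle _ _ (leq_maxr n N)) _ (IHs _ sy).
exists N; rewrite eqEsubv subvf /= -(span_basis (vbasisP {:H})).
exact/span_subvP.
Qed.

Definition depth S F (hF : hopf_filtration S F) (exF : exhaustive F) : nat :=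
  ex_minn (filt_full hF exF).

End HopfStructure.
End Hopf.

Section QuotientSpace.
Variables (K : fieldType) (V : vectType K) (W : {vspace V}).

Definition vquot : Type := Quotient.quot (W : {pred V}).

HB.instance Definition _ := Choice.on vquot.
HB.instance Definition _ := EqQuotient.on vquot.
HB.instance Definition _ := GRing.Zmodule.on vquot.

Definition vpi (x : V) : vquot := \pi_(Quotient.quot (W : {pred V})) x.

Lemma vpi_eq x y : (vpi x == vpi y) = (x - y \in W).
Proof. by rewrite Quotient.idealrBE. Qed.

Lemma vpi_repr (q : vquot) : vpi (repr q) = q. Proof. exact: reprK. Qed.

Lemma vpiD x y : vpi (x + y) = vpi x + vpi y.
Proof. by rewrite /vpi piE. Qed.

Definition vquot_scale (a : K) (q : vquot) : vquot := vpi (a *: repr q).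

Lemma vpi_scale a x : vquot_scale a (vpi x) = vpi (a *: x).
Proof.
by apply/eqP; rewrite vpi_eq -scalerBr rpredZ // -vpi_eq vpi_repr.
Qed.

Fact vquot_scaleA a b q :
  vquot_scale a (vquot_scale b q) = vquot_scale (a * b) q.
Proof. by rewrite -[q]vpi_repr !vpi_scale scalerA. Qed.
Fact vquot_scale1 : left_id 1 vquot_scale.
Proof. by move=> q; rewrite -[q]vpi_repr vpi_scale scale1r. Qed.
Fact vquot_scaleDr : right_distributive vquot_scale +%R.
Proof.
move=> a p q; rewrite -[p]vpi_repr -[q]vpi_repr.
by rewrite -vpiD !vpi_scale scalerDr vpiD.
Qed.
Fact vquot_scaleDl q : {morph vquot_scale^~ q : a b / a + b}.
Proof. by move=> a b; rewrite -[q]vpi_repr !vpi_scale scalerDl vpiD. Qed.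

HB.instance Definition _ := GRing.Zmodule_isLmodule.Build K vquot
  vquot_scaleA vquot_scale1 vquot_scaleDr vquot_scaleDl.

Fact vpi_is_linear : linear vpi.
Proof. by move=> a x y; rewrite vpiD -vpi_scale. Qed.
HB.instance Definition _ := GRing.isLinear.Build K V vquot _ vpi vpi_is_linear.

Fact vquot_vect_iso : Vector.axiom (\dim (W^C)) vquot.
Proof.
have WC0 : (W^C :&: W = 0)%VS by rewrite capvC capv_compl.
pose p := daddv_pi (W^C)%VS W.
have pE x : vpi (p x) = vpi x.
  have xT: (x \in W^C + W)%VS by rewrite addvC addv_complf memvf.
  rewrite -[in RHS](daddv_pi_add WC0 xT) vpiD -[LHS]addr0; congr (_ + _).
  by apply/eqP; rewrite eq_sym -[0](linear0 vpi) vpi_eq subr0 memv_pi.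
have pW x y : vpi x = vpi y -> p x = p y.
  move/eqP; rewrite vpi_eq => xyW; apply/eqP; rewrite -subr_eq0 -linearB /=.
  have: p (x - y) \in (W^C :&: W)%VS.
    rewrite memv_cap memv_pi -[_ \in W]/(p (x - y) \in W) -[p _]subr0 -vpi_eq.
    by rewrite pE linear0 -[0](linear0 vpi) vpi_eq subr0.
  by rewrite WC0 memv0.
have pid x : x \in (W^C)%VS -> p x = x by apply: daddv_pi_id.
pose b := vbasis (W^C)%VS.
exists (fun q : vquot => \row_i coord b i (p (repr q))).
  move=> a q r; apply/rowP=> i; rewrite !mxE -linearP; congr (coord _ _ _).
  by rewrite -[RHS]linearP; apply: pW; rewrite linearP /= !vpi_repr.
exists (fun v : 'rV_(\dim (W^C)) => vpi (\sum_i v 0 i *: b`_i)).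
  move=> q; rewrite -[RHS]vpi_repr -[RHS]pE.
  rewrite [in RHS](coord_vbasis (memv_pi (W^C)%VS W (repr q))).
  by congr (vpi _); apply: eq_bigr => i _; rewrite mxE.
move=> v; apply/rowP=> i; rewrite mxE (pW _ (\sum_i v 0 i *: b`_i)) ?vpi_repr //.
rewrite pid; last by apply: rpred_sum => j _; rewrite rpredZ ?vbasis_mem ?memt_nth.
by rewrite coord_sum_free // (basis_free (vbasisP (W^C)%VS)).
Qed.

HB.instance Definition _ := Lmodule_hasFinDim.Build K vquot vquot_vect_iso.

End QuotientSpace.

Section DirectSum.
Variables (K : fieldType) (n : nat) (V_ : 'I_n -> vectType K).

Definition dirsum : Type := {dffun forall i, V_ i}.

HB.instance Definition _ := Choice.on dirsum.

Implicit Types f g h : dirsum.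

Definition mkdirsum (f : forall i, V_ i) : dirsum := [ffun i => f i].
Definition proj f i : V_ i := f i.

Lemma projE (f : forall i, V_ i) i : proj (mkdirsum f) i = f i.
Proof. by rewrite /proj /mkdirsum ffunE. Qed.
Lemma dirsumP f g : (forall i, proj f i = proj g i) -> f = g.
Proof. by move=> efg; apply/ffunP. Qed.

Definition dirsum_zero := mkdirsum (fun=> 0).
Definition dirsum_opp f := mkdirsum (fun i => - proj f i).
Definition dirsum_add f g := mkdirsum (fun i => proj f i + proj g i).
Definition dirsum_scale a f := mkdirsum (fun i => a *: proj f i).

Fact dirsum_addA : associative dirsum_add.
Proof. by move=> f g h; apply: dirsumP => i; rewrite !projE addrA. Qed.
Fact dirsum_addC : commutative dirsum_add.
Proof. by move=> f g; apply: dirsumP => i; rewrite !projE addrC. Qed.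
Fact dirsum_add0 : left_id dirsum_zero dirsum_add.
Proof. by move=> f; apply: dirsumP => i; rewrite !projE add0r. Qed.
Fact dirsum_addN : left_inverse dirsum_zero dirsum_opp dirsum_add.
Proof. by move=> f; apply: dirsumP => i; rewrite !projE addNr. Qed.
HB.instance Definition _ := GRing.isZmodule.Build dirsum
  dirsum_addA dirsum_addC dirsum_add0 dirsum_addN.

Fact dirsum_scaleA a b f :
  dirsum_scale a (dirsum_scale b f) = dirsum_scale (a * b) f.
Proof. by apply: dirsumP => i; rewrite !projE scalerA. Qed.
Fact dirsum_scale1 : left_id 1 dirsum_scale.
Proof. by move=> f; apply: dirsumP => i; rewrite !projE scale1r. Qed.
Fact dirsum_scaleDr : right_distributive dirsum_scale +%R.
Proof. by move=> a f g; apply: dirsumP => i; rewrite !projE scalerDr. Qed.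
Fact dirsum_scaleDl f : {morph dirsum_scale^~ f : a b / a + b}.
Proof. by move=> a b; apply: dirsumP => i; rewrite !projE scalerDl. Qed.
HB.instance Definition _ := GRing.Zmodule_isLmodule.Build K dirsum
  dirsum_scaleA dirsum_scale1 dirsum_scaleDr dirsum_scaleDl.

Fact dirsum_vect_iso : Vector.axiom (\sum_i \dim {:V_ i}) dirsum.
Proof.
exists (fun f => \mxrow_i (\row_j coord (vbasis {:V_ i}) j (proj f i))).
  move=> a f g; apply/rowP=> k; rewrite !mxE.
  by rewrite -linearP; congr (coord _ _ _); rewrite !projE.
exists (fun r => mkdirsum (fun i =>
    \sum_j (submxrow r i) 0 j *: (vbasis {:V_ i})`_j)).
  move=> f; apply: dirsumP => i; rewrite projE mxrowK.
  rewrite [RHS](coord_vbasis (memvf _)).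
  by apply: eq_bigr => j _; rewrite mxE.
move=> r; rewrite -[RHS]submxrowK; apply: eq_mxrow => i; apply/rowP=> j.
by rewrite mxE projE coord_sum_free // (basis_free (vbasisP _)).
Qed.
HB.instance Definition _ := Lmodule_hasFinDim.Build K dirsum dirsum_vect_iso.

End DirectSum.

Section Graded.
Variables (K : fieldType) (H : hopf_data K) (F : nat -> {vspace H}).

(* H_{n-1}, with H_{-1} = 0 *)
Definition fpred n : {vspace H} := if n is n'.+1 then F n' else 0%VS.

(* H_n / H_{n-1} *)
Definition gr_piece n : vectType K :=
  vquot (linfun (@vsval K H (F n)) @^-1: fpred n)%VS.

(* Only used when F N is the whole of H, so that the pieces of degree > N     *)
(* vanish and the finite sum below is the full direct sum.                    *)
Variable N : nat.

Definition gr_space : vectType K := dirsum (fun n : 'I_N.+1 => gr_piece n).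

(* The class of x in H_n / H_{n-1}, placed in degree n; meaningful for x in   *)
(* H_n.  It is 0 for n > N.                                                   *)
Definition gr_class n (x : H) : gr_space :=
  mkdirsum (fun m : 'I_N.+1 =>
    if m == n :> nat then vpi _ (vsproj (F m) x) : gr_piece m else 0).

Definition gr_repr (a : gr_space) (n : 'I_N.+1) : H :=
  vsval (repr (proj a n)).

(* [x]_i [y]_j = [x y]_{i+j} *)
Definition gr_mu : 'Hom(tprod gr_space gr_space, gr_space) :=
  tlift (fun a b => \sum_(i < N.+1) \sum_(j < N.+1)
    gr_class (i + j)%N (hmul (gr_repr a i) (gr_repr b j))).

(* If Delta x = \sum_m t_m with t_m in H_m (x) H_{n-m}, then Delta [x]_n is   *)
(* the sum of the classes of the t_m in H_m/H_{m-1} (x) H_{n-m}/H_{n-m-1};    *)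
(* sumv_pi picks such a decomposition, on which the result does not depend.   *)
Definition gr_Delta : 'Hom(gr_space, tprod gr_space gr_space) :=
  linfun (fun a => \sum_(n < N.+1) \sum_(m < n.+1)
    tmap (linfun (gr_class m)) (linfun (gr_class (n - m)%N))
      (sumv_pi (\sum_(m < n.+1) tsub (F m) (F (n - m)%N))%VS m
        (hDelta H (gr_repr a n)))).

(* eps [x]_0 = eps x, and eps [x]_n = 0 for n > 0 *)
Definition gr_eps : 'Hom(gr_space, K^o) :=
  linfun (fun a => heps (gr_repr a ord0) : K^o).

Definition gr_upto : hopf_data K :=
  HopfData (gr_class 0 (hone H)) (HopfOps gr_mu gr_Delta gr_eps).

End Graded.

Definition gr (K : fieldType) (H : hopf_data K) (S : 'End(H))
    (F : nat -> {vspace H}) (hF : hopf_filtration S F) (exF : exhaustive F) :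
    hopf_data K :=
  gr_upto F (depth hF exF).

Section Variety.
Variable K : fieldType.

(* f^-1 o mu o (f (x) f), (f^-1 (x) f^-1) o Delta o f, eps o f *)
Definition pull (U V : vectType K) (f : 'Hom(U, V)) (h : hopf_ops V) :
    hopf_ops U :=
  HopfOps (f^-1 \o mu h \o tmap f f)%VF
          (tmap f^-1 f^-1 \o Delta h \o f)%VF
          (eps h \o f)%VF.

(* The dimension is written d.+1: a Hopf algebra is non-zero.                 *)
Definition hopf_variety d (p : hopf_ops 'rV[K]_d.+1) : Prop :=
  hopf_algebra (HopfData (delta_mx 0 0 : 'rV[K]_d.+1) p).

Definition hopf_orbit d (p q : hopf_ops 'rV[K]_d.+1) : Prop :=
  hopf_variety q /\
  exists f : 'End('rV[K]_d.+1), lker f == 0%VS /\ q = pull f p.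

Definition sc_index n : finType :=
  (('I_n * 'I_n * 'I_n) + ('I_n * 'I_n * 'I_n) + 'I_n)%type.

Lemma card_sc_index n : #|sc_index n| = (2 * n ^ 3 + n)%N.
Proof. by rewrite !card_sum !card_prod card_ord !expnS expn0; lia. Qed.

(* C_{ij}^k, D_i^{jk}, xi_i *)
Definition sconst n (p : hopf_ops 'rV[K]_n) : {ffun sc_index n -> K} :=
  [ffun s => match s with
   | inl (inl (i, j, k)) =>
       mu p ((delta_mx 0 i : 'rV[K]_n) ⊗ (delta_mx 0 j : 'rV[K]_n)) 0 k
   | inl (inr (i, j, k)) =>
       tlift (fun x y : 'rV[K]_n => (x 0 j * y 0 k : K^o))
             (Delta p (delta_mx 0 i : 'rV[K]_n))
   | inr i => eps p (delta_mx 0 i : 'rV[K]_n)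
   end].

Definition zariski_closure (I : finType) (X : {ffun I -> K} -> Prop)
    (v : {ffun I -> K}) : Prop :=
  forall P : {mpoly K[#|I|]},
    (forall x, X x -> P.@[fun i => x (enum_val i)] = 0) ->
    P.@[fun i => v (enum_val i)] = 0.

Definition orbit_closure d (p q : hopf_ops 'rV[K]_d.+1) : Prop :=
  hopf_variety q /\
  zariski_closure (fun x => exists2 r, hopf_orbit p r & x = sconst r) (sconst q).

Definition unital_basis (H : hopf_data K) d (e : d.+1.-tuple H) : Prop :=
  basis_of {:H} e /\ tnth e ord0 = hone H.

Definition hopf_point (H : hopf_data K) d (e : d.+1.-tuple H) :
    hopf_ops 'rV[K]_d.+1 :=
  pull (linfun (fun v : 'rV[K]_d.+1 => \sum_i v 0 i *: tnth e i)) (hops H).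

(* The choice of the two bases does not matter, as orbits are stable under    *)
(* change of basis fixing the unit.                                           *)
Definition degeneration (H0 H : hopf_data K) : Prop :=
  exists d, [/\ \dim {:H0} = d.+1, \dim {:H} = d.+1 &
    forall (e0 : d.+1.-tuple H0) (e : d.+1.-tuple H),
      unital_basis e0 -> unital_basis e ->
      orbit_closure (hopf_point e) (hopf_point e0)].

End Variety.

(* Main.v *)
From HB Require Import structures.
Require Import Defs.
From mathcomp Require Import all_boot all_order all_algebra.
From mathcomp Require Import zify.
From mathcomp Require Import mpoly.

(* Projections P_n of H adapted to the filtration split every H_n as the      *)
(* direct sum of the images of P_0, .., P_n.  For t != 0 the automorphism     *)
(* rescale t = \sum_n t^n P_n pulls the structure of H back to an isomorphic  *)
(* one, whose multiplication is the sum of the t^(i+j-k) P_k mu (P_i (x) P_j), *)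
(* and similarly for the other maps.  Compatibility of the filtration with    *)
(* the structure maps kills all the terms with a negative exponent, so the    *)
(* structure is polynomial in t, and its value at t = 0 is isomorphic to      *)
(* gr(H).  A polynomial identity valid for all t != 0 holds at t = 0, as K is *)
(* infinite: applied to the axioms this shows that gr(H) is a Hopf algebra,   *)
(* and applied to the equations vanishing on the orbit of H it shows that     *)
(* gr(H) lies in the closure of the orbit.                                    *)

Set Implicit Arguments.
Unset Strict Implicit.
Unset Printing Implicit Defensive.

Import GRing.Theory.

Local Open Scope ring_scope.

(** * Families of vectors depending polynomially on a scalar *)

(** The complements of H_(n-1) in H_n cut out by [grproj] identify H with gr(H) as vector spaces.
    Pulling the structure of H back along the scaling of the n-th complement by t^n gives a curve of
    Hopf structures, isomorphic to H for t != 0 ([rescale_iso]). Since product, coproduct and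
    antipode respect the filtration, only non-negative powers of t occur and the curve extends to t
    = 0 ([polyfam_deform]); there only the degree-preserving components survive, and these form
    gr(H) ([ungrade_iso]). A polynomial vanishing at all t != 0 vanishes at 0 ([polyfam_eq0]), so
    the Hopf axioms ([limit_bialgebra], [limit_antipode]) and all equations satisfied on the orbit
    of H pass to t = 0. *)

Section PolynomialFamilies.
Variable K : fieldType.
Implicit Types U W Z : vectType K.

(** Exponents may repeat and the index type is free, so a sum of families is indexed by a disjoint
    union and a bilinear combination by a product, with no normal form to maintain. *)
Definition polyfam Z (g : K -> Z) : Prop :=
  exists (I : finType) (e : I -> nat) (c : I -> Z),
    forall t, g t = \sum_i t ^+ e i *: c i.

Lemma polyfam_eq Z (g1 g2 : K -> Z) : g1 =1 g2 -> polyfam g1 -> polyfam g2.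
Proof. by move=> eg [I [e [c gE]]]; exists I, e, c => t; rewrite -eg gE. Qed.

Lemma polyfam_monomial Z n (c : Z) : polyfam (fun t => t ^+ n *: c).
Proof.
exists 'I_1, (fun=> n), (fun=> c) => t.
by rewrite big_ord_recl big_ord0 addr0.
Qed.

Lemma polyfam_cst Z (c : Z) : polyfam (fun=> c).
Proof.
by apply: polyfam_eq (polyfam_monomial 0 c) => t; rewrite expr0 scale1r.
Qed.

Lemma polyfamD Z (g h : K -> Z) :
  polyfam g -> polyfam h -> polyfam (fun t => g t + h t).
Proof.
move=> [I [e [c gE]]] [J [e' [c' hE]]].
pose ee s := match s with inl i => e i | inr j => e' j end.
pose cc s := match s with inl i => c i | inr j => c' j end.
by exists (I + J)%type, ee, cc => t; rewrite big_sumType /= gE hE.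
Qed.

Lemma linfun_linear U Z (f : U -> Z) : linear f -> linfun f =1 f.
Proof.
move=> lf x; pose g : {linear U -> Z} :=
  HB.pack f (GRing.isLinear.Build K _ _ _ _ lf).
by rewrite -[f]/(g : _ -> _) lfunE.
Qed.

(** Expanding both arguments multiplies monomials, so exponents add. Scaling, evaluation of a family
    of maps and tensoring are all instances. *)
Lemma polyfam_bilin U W Z (B : U -> W -> Z) (g : K -> U) (h : K -> W) :
    (forall x, linear (B x)) -> (forall y, linear (B^~ y)) ->
  polyfam g -> polyfam h -> polyfam (fun t => B (g t) (h t)).
Proof.
move=> Br Bl [I [e [c gE]]] [J [e' [c' hE]]].
exists (I * J)%type, (fun s => e s.1 + e' s.2)%N, (fun s => B (c s.1) (c' s.2)).
move=> t; rewrite -(pair_big xpredT xpredT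
  (fun i j => t ^+ (e i + e' j) *: B (c i) (c' j))) /= gE hE.
(* [B] is a bare function; each partial map is wrapped in [linfun] so that the lemmas on linear maps
   apply. *)
rewrite -(linfun_linear (Bl _)) linear_sum; apply: eq_bigr => i _.
rewrite linearZ /= linfun_linear // -(linfun_linear (Br _)) linear_sum.
rewrite scaler_sumr; apply: eq_bigr => j _.
by rewrite linearZ /= linfun_linear // scalerA exprD.
Qed.

Lemma polyfam_scale Z (a : K -> K^o) (g : K -> Z) :
  polyfam a -> polyfam g -> polyfam (fun t => (a t : K) *: g t).
Proof.
apply: (@polyfam_bilin K^o Z Z (fun (a : K^o) z => (a : K) *: z)) => [x b u v|y b u v].
  by rewrite scalerDr !scalerA mulrC.
by rewrite scalerDl scalerA.
Qed.

Lemma polyfam_app U Z (f : K -> 'Hom(U, Z)) (u : K -> U) :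
  polyfam f -> polyfam u -> polyfam (fun t => f t (u t)).
Proof.
apply: (@polyfam_bilin 'Hom(U, Z) U Z (fun f => f)) => [f' a x y|y a f1 f2].
  by rewrite linearP.
by rewrite add_lfunE scale_lfunE.
Qed.

Lemma polyfam_lin U Z (f : 'Hom(U, Z)) (u : K -> U) :
  polyfam u -> polyfam (fun t => f (u t)).
Proof. exact: polyfam_app (polyfam_cst f). Qed.

Lemma polyfamB Z (g h : K -> Z) :
  polyfam g -> polyfam h -> polyfam (fun t => g t - h t).
Proof.
move=> pg ph; apply: polyfamD => //.
apply: polyfam_eq (polyfam_scale (polyfam_cst (-1 : K^o)) ph) => t.
by rewrite scaleN1r.
Qed.

Lemma polyfam_sum Z (I : Type) (r : seq I) (g : I -> K -> Z) :
  (forall i, polyfam (g i)) -> polyfam (fun t => \sum_(i <- r) g i t).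
Proof.
move=> pg; elim: r => [|i r IHr].
  by apply: polyfam_eq (polyfam_cst 0) => t; rewrite big_nil.
by apply: polyfam_eq (polyfamD (pg i) IHr) => t; rewrite big_cons.
Qed.

Lemma polyfam_mul (a b : K -> K^o) :
  polyfam a -> polyfam b -> polyfam (fun t => (a t : K) * (b t : K) : K^o).
Proof. exact: polyfam_scale. Qed.

Lemma polyfam_exp (a : K -> K^o) n :
  polyfam a -> polyfam (fun t => (a t : K) ^+ n : K^o).
Proof.
move=> pa; elim: n => [|n IHn]; first exact: polyfam_cst.
by apply: (@polyfam_eq K^o _ _ _ (polyfam_mul pa IHn)) => t; rewrite exprS.
Qed.

Lemma polyfam_prod (I : Type) (r : seq I) (a : I -> K -> K^o) :
  (forall i, polyfam (a i)) ->
  polyfam (fun t => \prod_(i <- r) (a i t : K) : K^o).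
Proof.
move=> pa; elim: r => [|i r IHr].
  by apply: (@polyfam_eq K^o _ _ _ (polyfam_cst (1 : K^o))) => t; rewrite big_nil.
by apply: (@polyfam_eq K^o _ _ _ (polyfam_mul (pa i) IHr)) => t; rewrite big_cons.
Qed.

Lemma polyfam_meval n (P : {mpoly K[n]}) (v : K -> 'I_n -> K) :
    (forall i, polyfam (fun t => v t i : K^o)) ->
  polyfam (fun t => P.@[v t] : K^o).
Proof.
move=> pv; apply: (@polyfam_eq K^o
  (fun t => \sum_(m <- msupp P) P@_m * \prod_i v t i ^+ m i)).
  by move=> t; rewrite mevalE.
apply: polyfam_sum => m; apply: polyfam_mul; first exact: polyfam_cst.
by apply: polyfam_prod => i; apply: polyfam_exp.
Qed.

(** [tlift] only reads [f] on basis vectors, so this expansion holds for any function [f], whereas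
    [tliftE] concerns bilinear ones. *)
Lemma tliftDE U W Z (f : U -> W -> Z) (s : tprod U W) :
  tlift f s = \sum_i \sum_j s i j *: f (vbasis {:U})`_i (vbasis {:W})`_j.
Proof.
by rewrite /tlift linfun_linear //; apply: tlift_fun_linear.
Qed.

Lemma tensDr U W (u : U) : linear (@tens K U W u).
Proof. by move=> a x y; apply/matrixP => i j; rewrite !mxE linearP mulrDr mulrCA. Qed.

Lemma tensDl U W (w : W) : linear ((@tens K U W)^~ w).
Proof. by move=> a x y; apply/matrixP => i j; rewrite !mxE linearP mulrDl mulrA. Qed.

Lemma polyfam_tens U W (u : K -> U) (w : K -> W) :
  polyfam u -> polyfam w -> polyfam (fun t => u t ⊗ w t).
Proof. by apply: polyfam_bilin; [apply: tensDr|apply: tensDl]. Qed.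

Lemma polyfam_entry m n (g : K -> 'M[K]_(m, n)) i j :
  polyfam g -> polyfam (fun t => g t i j : K^o).
Proof.
move=> pg; pose c (m : 'M[K]_(m, n)) : K^o := m i j.
have lc : linear c by move=> a x y; rewrite /c !mxE.
by apply: polyfam_eq (polyfam_lin (linfun c) pg) => t; rewrite linfun_linear.
Qed.

Lemma polyfam_tlift U W Z (f : K -> U -> W -> Z) (s : K -> tprod U W) :
    (forall x y, polyfam (fun t => f t x y)) -> polyfam s ->
  polyfam (fun t => tlift (f t) (s t)).
Proof.
move=> pf ps; apply: (@polyfam_eq Z (fun t => \sum_i \sum_j
    s t i j *: f t (vbasis {:U})`_i (vbasis {:W})`_j)).
  by move=> t; rewrite tliftDE.
apply: polyfam_sum => i; apply: polyfam_sum => j; apply: polyfam_scale => //.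
exact: polyfam_entry.
Qed.

(** Each coordinate of [g] is a polynomial in t; in characteristic 0 it vanishes at more nonzero
    integers than its degree allows, so it is zero. *)
Lemma polyfam_eq0 Z (g : K -> Z) : [pchar K] =i pred0 -> polyfam g ->
  (forall t, t != 0 -> g t = 0) -> g 0 = 0.
Proof.
move=> charK [I [e [c gE]]] g0.
rewrite [g 0](coord_vbasis (memvf _)) big1 // => k _.
pose p := \sum_i coord (vbasis {:Z}) k (c i) *: 'X^(e i) : {poly K}.
have pE t : p.[t] = coord (vbasis {:Z}) k (g t).
  rewrite gE horner_sum linear_sum; apply: eq_bigr => i _.
  by rewrite linearZ hornerZ hornerXn mulrC.
rewrite -pE; suff -> : p = 0 by rewrite horner0 scale0r.
(* The roots 1, ..., [size p] avoid 0, the one point where nothing is known about [g]. *)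
pose rs := [seq n.+1%:R | n <- iota 0 (size p)] : seq K.
apply: (@roots_geq_poly_eq0 K p rs); last by rewrite size_map size_iota.
  apply/allP => _ /mapP[n _ ->]; rewrite /root pE g0 ?linear0 //.
  by rewrite ((pcharf0P K).1 charK).
rewrite map_inj_uniq ?iota_uniq // => m n.
have nat_inj (a b : nat) : a%:R = b%:R :> K -> (a <= b)%N.
  move=> eab; rewrite leqNgt; apply/negP => lt_ba.
  have: (a - b)%:R == 0 :> K by rewrite natrB ?(ltnW lt_ba) // eab subrr.
  by rewrite ((pcharf0P K).1 charK) subn_eq0 leqNgt lt_ba.
by move=> emn; apply/eqP; rewrite -eqSS eqn_leq !nat_inj.
Qed.

Lemma polyfam_limit Z (g h : K -> Z) : [pchar K] =i pred0 ->
    polyfam g -> polyfam h -> (forall t, t != 0 -> g t = h t) -> g 0 = h 0.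
Proof.
move=> charK pg ph egh; apply/eqP; rewrite -subr_eq0; apply/eqP.
apply: (polyfam_eq0 charK (polyfamB pg ph)) => t nz_t.
by rewrite egh ?subrr.
Qed.

End PolynomialFamilies.

(** * Tensor products and isomorphisms of Hopf algebras *)

Section TensorTheory.
Variable K : fieldType.
Implicit Types U V W Z : vectType K.

Lemma eq_tlift U W Z (f g : U -> W -> Z) (s : tprod U W) :
  (forall u w, f u w = g u w) -> tlift f s = tlift g s.
Proof.
move=> efg; rewrite !tliftDE; apply: eq_bigr => i _.
by apply: eq_bigr => j _; rewrite efg.
Qed.

(** A coefficient matrix is a combination of elementary matrices, which are the tensors of basis
    vectors. Identities between maps on a tensor product are thereby checked on pure tensors. *)
Lemma tprod_hom_ext U W Z (f g : 'Hom(tprod U W, Z)) :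
  (forall u w, f (u ⊗ w) = g (u ⊗ w)) -> f = g.
Proof.
move=> efg; apply/lfunP => s.
have -> : s = tlift (@tens K U W) s.
  rewrite tliftDE [LHS]matrix_sum_delta; apply: eq_bigr => i _.
  apply: eq_bigr => j _; congr (_ *: _); apply/matrixP => k l.
  rewrite !mxE !coord_free ?(basis_free (vbasisP _)) //.
  by rewrite -natrM mulnb (eq_sym k) (eq_sym l).
rewrite tliftDE !linear_sum; apply: eq_bigr => i _.
by rewrite !linear_sum; apply: eq_bigr => j _; rewrite !linearZ /= efg.
Qed.

Lemma linear_tlift U W Z V (f : V -> U -> W -> Z) (s : tprod U W) :
  (forall u w, linear (fun x => f x u w)) -> linear (fun x => tlift (f x) s).
Proof.
move=> lf a x y; rewrite !tliftDE scaler_sumr -big_split.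
apply: eq_bigr => i _; rewrite scaler_sumr -big_split.
by apply: eq_bigr => j _; rewrite lf scalerDr !scalerA mulrC.
Qed.

Lemma lfun_tlift U W Z V (h : 'Hom(Z, V)) (f : U -> W -> Z) (s : tprod U W) :
  h (tlift f s) = tlift (fun u w => h (f u w)) s.
Proof.
rewrite !tliftDE linear_sum; apply: eq_bigr => i _.
by rewrite linear_sum; apply: eq_bigr => j _; rewrite linearZ.
Qed.

Lemma tmapE U W U' W' (f : 'Hom(U, U')) (g : 'Hom(W, W')) u w :
  tmap f g (u ⊗ w) = f u ⊗ g w.
Proof.
rewrite /tmap tliftE // => [x|y] a v v'; rewrite linearP.
  exact: tensDr.
exact: tensDl.
Qed.

Lemma tmap_comp U W U' W' U'' W'' (f : 'Hom(U, U')) (g : 'Hom(W, W'))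
    (f' : 'Hom(U', U'')) (g' : 'Hom(W', W'')) s :
  tmap f' g' (tmap f g s) = tmap (f' \o f) (g' \o g) s.
Proof.
rewrite -comp_lfunE; congr (fun_of_lfun _ s); apply: tprod_hom_ext => u w.
by rewrite comp_lfunE !tmapE !comp_lfunE.
Qed.

Lemma tmap_id U W (s : tprod U W) : tmap \1 \1 s = s.
Proof.
rewrite -[RHS]id_lfunE; congr (fun_of_lfun _ s).
by apply: tprod_hom_ext => u w; rewrite tmapE !id_lfunE.
Qed.

Lemma tlift_tmap U W U' W' Z (B : U' -> W' -> Z) (f : 'Hom(U, U'))
    (g : 'Hom(W, W')) (s : tprod U W) :
    (forall x, linear (B x)) -> (forall y, linear (B^~ y)) ->
  tlift B (tmap f g s) = tlift (fun u w => B (f u) (g w)) s.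
Proof.
move=> Br Bl; rewrite -comp_lfunE; congr (fun_of_lfun _ s).
apply: tprod_hom_ext => u w; rewrite comp_lfunE tmapE !tliftE // => [x|y] a v v'.
  by rewrite linearP; apply: (Br (f x)).
by rewrite linearP; apply: (Bl (g y)).
Qed.

Lemma tassocE U V W (u : U) (v : V) (w : W) :
  tassoc U V W ((u ⊗ v) ⊗ w) = u ⊗ (v ⊗ w).
Proof.
have lv (x : U) (y : W) : linear (fun v => x ⊗ (v ⊗ y)).
  by move=> a v1 v2; rewrite tensDl tensDr.
have lu (x : V) (y : W) : linear (fun u => u ⊗ (x ⊗ y)).
  by move=> a u1 u2; rewrite tensDl.
rewrite /tassoc tliftE; last by move=> y a s t; rewrite linearP.
  by rewrite tliftE.
by move=> s; apply: linear_tlift => x y a w1 w2; rewrite !tensDr.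
Qed.

Lemma tassoc_tmap U V W U' V' W' (f : 'Hom(U, U')) (g : 'Hom(V, V'))
    (h : 'Hom(W, W')) s :
  tmap f (tmap g h) (tassoc U V W s) = tassoc U' V' W' (tmap (tmap f g) h s).
Proof.
rewrite -!comp_lfunE; congr (fun_of_lfun _ s).
apply: tprod_hom_ext => r w.
(* For fixed [w] the map is linear in [r], so extensionality applies a second time, to the inner
   tensor product. *)
have linE Z (k : 'Hom(tprod (tprod U V) W, Z)) :
    linfun (fun r => k (r ⊗ w)) =1 (fun r => k (r ⊗ w)).
  by apply: linfun_linear => a x y; rewrite tensDl linearP.
rewrite -linE -[RHS]linE; congr (fun_of_lfun _ r).
apply: tprod_hom_ext => u v.
by rewrite !linE !comp_lfunE tassocE !tmapE tassocE.
Qed.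

(** [f^-1] exists for every linear map as a mere pseudo-inverse; an explicit two-sided inverse [g]
    shows that it is a true one. *)
Lemma cancel_lfunV U W (f : 'Hom(U, W)) (g : W -> U) :
  cancel f g -> cancel g f -> cancel f f^-1%VF /\ cancel f^-1%VF f.
Proof.
move=> fK gK; have fVK : cancel f f^-1%VF.
  by apply/lker0_lfunK/lker0P/can_inj/fK.
by split=> // y; rewrite -{1}[y]gK fVK gK.
Qed.

End TensorTheory.

(** * Transport of Hopf structures along isomorphisms *)

Section HopfIso.
Variable K : fieldType.

Section Multiplication.
Variable A : hopf_data K.

Lemma hmulDr (x : A) : linear (hmul x).
Proof. by move=> a y z; rewrite /hmul tensDr linearP. Qed.

Lemma hmulDl (y : A) : linear ((@hmul K A)^~ y).
Proof. by move=> a x z; rewrite /hmul tensDl linearP. Qed.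

End Multiplication.

Record hopf_iso (A B : hopf_data K) (f : 'Hom(A, B)) : Prop := HopfIso {
  hiK : cancel f f^-1%VF;
  hiVK : cancel f^-1%VF f;
  hi1 : f (hone A) = hone B;
  hiM : forall x y, f (hmul x y) = hmul (f x) (f y);
  hiD : forall x, tmap f f (hDelta A x) = hDelta B (f x);
  hiE : forall x, heps (f x) = heps x
}.

Lemma tmapK (U V W Z : vectType K) (f : 'Hom(U, V)) (f' : 'Hom(V, U))
    (g : 'Hom(W, Z)) (g' : 'Hom(Z, W)) :
  cancel f f' -> cancel g g' -> cancel (tmap f g) (tmap f' g').
Proof.
move=> fK gK s; rewrite tmap_comp -[RHS]tmap_id.
congr (fun_of_lfun (tmap _ _) s); apply/lfunP => x.
  by rewrite comp_lfunE id_lfunE fK.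
by rewrite comp_lfunE id_lfunE gK.
Qed.

Lemma tmul_bilin (A : hopf_data K) (c d : A) :
  (forall a, linear (fun b => hmul a c ⊗ hmul b d)) /\
  (forall b, linear (fun a => hmul a c ⊗ hmul b d)).
Proof.
split=> x a y z; rewrite (hmulDl _ a); first exact: tensDr.
exact: tensDl.
Qed.

Lemma tmap_tmul (A B : hopf_data K) (f : 'Hom(A, B)) (s t : tprod A A) :
    (forall x y, f (hmul x y) = hmul (f x) (f y)) ->
  tmap f f (tmul s t) = tmul (tmap f f s) (tmap f f t).
Proof.
move=> fM; rewrite /tmul lfun_tlift tlift_tmap; first last.
- by move=> b; apply: linear_tlift => c d; apply: (tmul_bilin c d).2.
- by move=> a; apply: linear_tlift => c d; apply: (tmul_bilin c d).1.
apply: eq_tlift => a b; rewrite lfun_tlift tlift_tmap => [|c|d] //; first last.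
- by move=> k x y; rewrite hmulDr tensDl.
- by move=> k x y; rewrite hmulDr tensDr.
by apply: eq_tlift => c d; rewrite tmapE !fM.
Qed.

Section Transport.
Variables (A B : hopf_data K) (f : 'Hom(A, B)).
Hypothesis isof : hopf_iso f.

Let f_inj : injective f := can_inj (hiK isof).
Let ff_inj : injective (tmap f f) := can_inj (tmapK (hiK isof) (hiK isof)).

(** [f] and its tensor powers are injective and intertwine the structures, so each axiom of [B] can
    be read back in [A]. *)
Lemma hopf_iso_bialgebra : bialgebra B -> bialgebra A.
Proof.
case=> mA m1x mx1 DA el er DM D1 eM e1; split.
- by move=> x y z; apply: f_inj; rewrite !(hiM isof) mA.
- by move=> x; apply: f_inj; rewrite (hiM isof) (hi1 isof) m1x.
- by move=> x; apply: f_inj; rewrite (hiM isof) (hi1 isof) mx1.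
- move=> x.
  apply: (can_inj (tmapK (hiK isof) (tmapK (hiK isof) (hiK isof)))).
  have Df : (tmap f f \o hDelta A = hDelta B \o f)%VF.
    by apply/lfunP => y; rewrite !comp_lfunE (hiD isof).
  have f1 : (f \o \1 = \1 \o f)%VF by rewrite comp_lfun1l comp_lfun1r.
  by rewrite tassoc_tmap !tmap_comp Df f1 -!tmap_comp (hiD isof) DA.
- move=> x; apply: f_inj; rewrite -[in RHS](el (f x)) -(hiD isof) lfun_tlift.
  rewrite tlift_tmap => [|a k y z|b k y z].
  + by apply: eq_tlift => a b; rewrite linearZ /= (hiE isof).
  + by rewrite scalerDr !scalerA mulrC.
  + by rewrite /heps linearP scalerDl scalerA.
- move=> x; apply: f_inj; rewrite -[in RHS](er (f x)) -(hiD isof) lfun_tlift.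
  rewrite tlift_tmap => [|a k y z|b k y z].
  + by apply: eq_tlift => a b; rewrite linearZ /= (hiE isof).
  + by rewrite /heps linearP scalerDl scalerA.
  + by rewrite scalerDr !scalerA mulrC.
- move=> x y; apply: ff_inj; rewrite tmap_tmul; last exact: hiM isof.
  by rewrite !(hiD isof) (hiM isof) DM.
- by apply: ff_inj; rewrite (hiD isof) tmapE (hi1 isof) D1.
- by move=> x y; rewrite -!(hiE isof) (hiM isof) eM.
- by rewrite -(hiE isof) (hi1 isof) e1.
Qed.

(** [SA] is prescribed rather than defined as a conjugate of [SB], so that an explicit formula
    polynomial in t can be used for it. *)
Lemma hopf_iso_antipode (SA : 'End(A)) (SB : 'End(B)) :
  (forall x, f (SA x) = SB (f x)) -> antipode SB -> antipode SA.
Proof.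
move=> fS [Sl Sr]; split=> x; apply: f_inj.
  rewrite linearZ /= (hi1 isof) -(hiE isof) -Sl -(hiD isof) lfun_tlift.
  rewrite tlift_tmap => [|a|b k y z].
  + by apply: eq_tlift => a b; rewrite (hiM isof) fS.
  + exact: hmulDr.
  + by rewrite linearP; apply: (hmulDl b).
rewrite linearZ /= (hi1 isof) -(hiE isof) -Sr -(hiD isof) lfun_tlift.
rewrite tlift_tmap => [|a k y z|b].
+ by apply: eq_tlift => a b; rewrite (hiM isof) fS.
+ by rewrite linearP hmulDr.
+ exact: hmulDl.
Qed.

Lemma hopf_iso_algebra : hopf_algebra B -> hopf_algebra A.
Proof.
case=> bB [S aS]; split; first exact: hopf_iso_bialgebra.
exists (f^-1 \o S \o f)%VF; apply: hopf_iso_antipode aS => x.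
by rewrite !comp_lfunE (hiVK isof).
Qed.

(** This turns an isomorphism onto [B] into the witness demanded by [hopf_orbit]. *)
Lemma hopf_iso_pull : hops A = pull f (hops B).
Proof.
case: A f isof => V u [m D e] /= g isog; rewrite /pull; congr HopfOps.
- apply: tprod_hom_ext => x y; rewrite !comp_lfunE tmapE.
  by rewrite -[mu _ _]/(hmul _ _) -(hiM isog) (hiK isog).
- apply/lfunP => x; rewrite !comp_lfunE -[Delta _ _]/(hDelta B _).
  by rewrite -(hiD isog) (tmapK (hiK isog) (hiK isog)).
- by apply/lfunP => x; rewrite !comp_lfunE; apply: esym; apply: (hiE isog x).
Qed.

Lemma hopf_iso_inv : hopf_iso f^-1%VF.
Proof.
have [V1 V2] := cancel_lfunV (hiVK isof) (hiK isof).
split=> // [|x y|x|x].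
- by rewrite -(hi1 isof) (hiK isof).
- by apply: f_inj; rewrite (hiM isof) !(hiVK isof).
- by apply: ff_inj; rewrite (hiD isof) (tmapK (hiVK isof) (hiVK isof)) (hiVK isof).
- by rewrite -(hiE isof) (hiVK isof).
Qed.

End Transport.

Lemma hopf_iso_comp (A B C : hopf_data K) (f : 'Hom(A, B)) (g : 'Hom(B, C)) :
  hopf_iso f -> hopf_iso g -> hopf_iso (g \o f)%VF.
Proof.
move=> isof isog.
have [||V1 V2] := @cancel_lfunV _ _ _ (g \o f)%VF (fun x => f^-1%VF (g^-1%VF x)).
- by move=> x; rewrite comp_lfunE (hiK isog) (hiK isof).
- by move=> x; rewrite comp_lfunE (hiVK isof) (hiVK isog).
split=> // [|x y|x|x]; rewrite ?comp_lfunE.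
- by rewrite (hi1 isof) (hi1 isog).
- by rewrite (hiM isof) (hiM isog).
- by rewrite -(hiD isog) -(hiD isof) tmap_comp.
- by rewrite (hiE isog) (hiE isof).
Qed.

Lemma pull_hopf_iso (U : vectType K) (B : hopf_data K) (f : 'Hom(U, B)) (u : U) :
    cancel f f^-1%VF -> cancel f^-1%VF f -> f u = hone B ->
  @hopf_iso (HopfData u (pull f (hops B))) B f.
Proof.
move=> fK fVK fu; split=> // [x y|x|x].
- by rewrite /hmul /= !comp_lfunE tmapE fVK.
- by rewrite /hDelta /= !comp_lfunE (tmapK fVK fVK).
- by rewrite /heps /= comp_lfunE.
Qed.

End HopfIso.

(** * Limits of polynomial families of Hopf algebras *)

Section Limit.
Variables (K : fieldType) (V : vectType K) (u : V).
Variables (h : K -> hopf_ops V) (S : K -> 'End(V)).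
Hypothesis charK : [pchar K] =i pred0.
Hypothesis polyfam_mu : polyfam (fun t => mu (h t)).
Hypothesis polyfam_Delta : polyfam (fun t => Delta (h t)).
Hypothesis polyfam_eps : polyfam (fun t => eps (h t)).
Hypothesis polyfam_S : polyfam S.

Let Ht t := HopfData u (h t).
Let mul t : V -> V -> V := @hmul _ (Ht t).
Let cop t : 'Hom(V, tprod V V) := hDelta (Ht t).
Let cou t : V -> K^o := @heps _ (Ht t).

Let pmul (x y : K -> V) : polyfam x -> polyfam y ->
  polyfam (fun t => mul t (x t) (y t)).
Proof. by move=> px py; exact: (polyfam_app polyfam_mu (polyfam_tens px py)). Qed.

Let pcop (x : K -> V) : polyfam x -> polyfam (fun t => cop t (x t)).
Proof. exact: polyfam_app polyfam_Delta. Qed.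

Let pcou (x : K -> V) : polyfam x -> polyfam (fun t => cou t (x t)).
Proof. exact: polyfam_app polyfam_eps. Qed.

Let cst (Z : vectType K) (z : Z) := polyfam_cst z.

Let ptmul (r s : K -> tprod V V) : polyfam r -> polyfam s ->
  polyfam (fun t => @tmul _ (Ht t) (r t) (s t) : tprod V V).
Proof.
move=> pr ps; apply: (polyfam_tlift (f := fun t a b =>
  tlift (fun c d => mul t a c ⊗ mul t b d) (s t))) => // a b.
apply: (polyfam_tlift (f := fun t c d => mul t a c ⊗ mul t b d)) => // c d.
exact: polyfam_tens (pmul (cst a) (cst c)) (pmul (cst b) (cst d)).
Qed.

Let ptmap (U W U' W' : vectType K) (f : K -> 'Hom(U, U'))
    (g : K -> 'Hom(W, W')) (s : K -> tprod U W) :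
    polyfam f -> polyfam g -> polyfam s ->
  polyfam (fun t => tmap (f t) (g t) (s t)).
Proof.
move=> pf pg ps; apply: (polyfam_tlift (f := fun t a b => f t a ⊗ g t b)) => // a b.
exact: polyfam_tens (polyfam_app pf (cst a)) (polyfam_app pg (cst b)).
Qed.

(** Each axiom equates two expressions built from the structure maps by operations preserving
    [polyfam], hence persists at t = 0. *)
Lemma limit_bialgebra :
  (forall t, t != 0 -> bialgebra (Ht t)) -> bialgebra (Ht 0).
Proof.
move=> bi; split.
- move=> x y z; apply: (polyfam_limit charK
    (pmul (cst x) (pmul (cst y) (cst z)))
    (pmul (pmul (cst x) (cst y)) (cst z))) => t /bi bt.
  exact: hmulA bt x y z.
- move=> x; apply: (polyfam_limit charK (pmul (cst u) (cst x)) (cst x)) => t /bi bt.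
  exact: hmul1x bt x.
- move=> x; apply: (polyfam_limit charK (pmul (cst x) (cst u)) (cst x)) => t /bi bt.
  exact: hmulx1 bt x.
- move=> x; apply: (polyfam_limit charK
    (polyfam_lin (tassoc V V V) (ptmap polyfam_Delta (cst \1%VF) (pcop (cst x))))
    (ptmap (cst \1%VF) polyfam_Delta (pcop (cst x)))) => t /bi bt.
  exact: hDeltaA bt x.
- move=> x; apply: (polyfam_limit charK
    (polyfam_tlift (f := fun t a b => (cou t a : K) *: b)
      (fun a b => polyfam_scale (pcou (cst a)) (cst b)) (pcop (cst x)))
    (cst x)) => t /bi bt.
  exact: heps_l bt x.
- move=> x; apply: (polyfam_limit charK
    (polyfam_tlift (f := fun t a b => (cou t b : K) *: a)
      (fun a b => polyfam_scale (pcou (cst b)) (cst a)) (pcop (cst x)))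
    (cst x)) => t /bi bt.
  exact: heps_r bt x.
- move=> x y; apply: (polyfam_limit charK
    (pcop (pmul (cst x) (cst y)))
    (ptmul (pcop (cst x)) (pcop (cst y)))) => t /bi bt.
  exact: hDeltaM bt x y.
- apply: (polyfam_limit charK (pcop (cst u)) (cst (u ⊗ u))) => t /bi bt.
  exact: hDelta1 bt.
- move=> x y; apply: (polyfam_limit charK
    (pcou (pmul (cst x) (cst y)))
    (polyfam_mul (pcou (cst x)) (pcou (cst y)))) => t /bi bt.
  exact: hepsM bt x y.
- apply: (polyfam_limit charK (pcou (cst u)) (cst (1 : K^o))) => t /bi bt.
  exact: heps1 bt.
Qed.

(** Existence of an antipode is not an equation, so an explicit polynomial family [S] of antipodes
    is carried to the limit. *)
Lemma limit_antipode :
  (forall t, t != 0 -> @antipode _ (Ht t) (S t)) -> @antipode _ (Ht 0) (S 0).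
Proof.
move=> an; split=> x.
  apply: (polyfam_limit charK
    (polyfam_tlift (f := fun t a b => mul t (S t a) b)
      (fun a b => pmul (polyfam_app polyfam_S (cst a)) (cst b)) (pcop (cst x)))
    (polyfam_scale (pcou (cst x)) (cst u))) => t /an at_.
  exact: antipode_l at_ x.
apply: (polyfam_limit charK
  (polyfam_tlift (f := fun t a b => mul t a (S t b))
    (fun a b => pmul (cst a) (polyfam_app polyfam_S (cst b))) (pcop (cst x)))
  (polyfam_scale (pcou (cst x)) (cst u))) => t /an at_.
exact: antipode_r at_ x.
Qed.

End Limit.

(** * The deformation of a filtered Hopf algebra to its graded algebra *)

Section BilinearSums.
Variable K : fieldType.

Lemma bilin_sum (U W Z : vectType K) (B : U -> W -> Z) (I J : finType)
    (a : I -> K) (b : J -> K) (x : I -> U) (y : J -> W) :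
    (forall x, linear (B x)) -> (forall y, linear (B^~ y)) ->
  B (\sum_i a i *: x i) (\sum_j b j *: y j) =
    \sum_i \sum_j (a i * b j) *: B (x i) (y j).
Proof.
move=> Br Bl; rewrite -(linfun_linear (Bl _)) linear_sum.
apply: eq_bigr => i _; rewrite linearZ /= linfun_linear //.
rewrite -(linfun_linear (Br _)) linear_sum scaler_sumr.
by apply: eq_bigr => j _; rewrite linearZ /= linfun_linear // scalerA.
Qed.

Lemma sub_lfunE (U W : vectType K) (f g : 'Hom(U, W)) x : (f - g)%R x = f x - g x.
Proof. by rewrite add_lfunE opp_lfunE. Qed.

Lemma tmapZ (U U' W W' : vectType K) (f : 'Hom(U, U')) (g : 'Hom(W, W'))
    (a b : K) (s : tprod U W) :
  tmap (a *: f) (b *: g) s = (a * b) *: tmap f g s.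
Proof.
rewrite -scale_lfunE; congr (fun_of_lfun _ s); apply: tprod_hom_ext => u w.
rewrite scale_lfunE !tmapE !scale_lfunE; apply/matrixP => i j.
by rewrite !mxE !linearZ /= mulrACA.
Qed.

Lemma tsub_ext (U W Z : vectType K) (A : {vspace U}) (B : {vspace W})
    (f g : 'Hom(tprod U W, Z)) :
    {in A & B, forall u w, f (u ⊗ w) = g (u ⊗ w)} ->
  {in tsub A B, f =1 g}.
Proof.
move=> efg s; suff /subvP sub : (tsub A B <= lker (f - g))%VS.
  by move/sub; rewrite memv_ker sub_lfunE subr_eq0 => /eqP.
apply/span_subvP => _ /allpairsP[[u w] /= [uA wB ->]].
by rewrite memv_ker sub_lfunE efg ?subrr // vbasis_mem.
Qed.

End BilinearSums.

Section GradedProjections.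
Variables (K : fieldType) (H : hopf_data K) (S : 'End(H)).
Variable F : nat -> {vspace H}.
Hypothesis filtF : hopf_filtration S F.
Variable N : nat.
Hypothesis F_N : F N = fullv.

Lemma filt_le m n : (m <= n)%N -> (F m <= F n)%VS.
Proof.
elim: n => [|n IHn]; first by rewrite leqn0 => /eqP->.
rewrite leq_eqVlt ltnS => /predU1P[-> //|/IHn/subv_trans]; apply.
exact: filt_incr filtF n.
Qed.

Lemma fpred_sub n : (fpred F n <= F n)%VS.
Proof. by case: n => [|n] /=; rewrite ?sub0v ?filt_le. Qed.

Lemma filt_fpred m n : (m < n)%N -> (F m <= fpred F n)%VS.
Proof. by case: n => // n; rewrite ltnS; apply: filt_le. Qed.

(** * Projections adapted to the filtration *)

Fixpoint descproj k : 'End(H) :=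
  if k is k'.+1 then (projv (F (N - k'.+1)) \o descproj k')%VF else \1%VF.

(* Composing the projections onto F_N, F_{N-1}, .., F_n, rather than using    *)
(* projv (F n) alone, makes filtproj m \o filtproj n = filtproj m for m <= n. *)
Definition filtproj n := descproj (N - n).

Lemma filtproj_mem n x : filtproj n x \in F n.
Proof.
rewrite /filtproj; have [lt_nN|] := ltnP n N; last first.
  by move=> /filt_le/subvP; apply; rewrite F_N memvf.
rewrite -[X in _ \in F X](subKn (ltnW lt_nN)) -(subnSK lt_nN) /=.
by rewrite comp_lfunE memv_proj.
Qed.

Lemma descproj_id k x : x \in F (N - k)%N -> descproj k x = x.
Proof.
elim: k => [|k IHk] /=; first by rewrite id_lfunE.
move=> Fx; rewrite comp_lfunE IHk ?projv_id //.
by apply: subvP Fx; apply: filt_le; apply: leq_sub2l.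
Qed.

Lemma filtproj_id n x : x \in F n -> filtproj n x = x.
Proof.
move=> Fx; apply: descproj_id; have [le_nN|lt_Nn] := leqP n N.
  by rewrite subKn.
(* [N <= n] is by definition the equation [N - n == 0], which [eqP] turns into a rewrite rule. *)
by rewrite (eqP (ltnW lt_Nn)) subn0 F_N memvf.
Qed.

Lemma filtprojK m n x : (m <= n)%N -> filtproj m (filtproj n x) = filtproj m x.
Proof.
move=> le_mn; rewrite /filtproj.
have [l ->] : exists l, (N - m = l + (N - n))%N.
  by exists ((N - m) - (N - n))%N; rewrite subnK ?leq_sub2l.
elim: l => [|l IHl]; first by rewrite add0n; apply: filtproj_id (filtproj_mem n x).
by rewrite addSn /= !comp_lfunE IHl.
Qed.

(** The projection onto a complement of H_(n-1) inside H_n; it is 0 for n > N, where both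
    projections are the identity. *)
Definition grproj n : 'End(H) :=
  if n is n'.+1 then (filtproj n - filtproj n')%VF else filtproj 0.

Lemma grproj_mem n x : grproj n x \in F n.
Proof.
case: n => [|n] /=; first exact: filtproj_mem.
rewrite sub_lfunE rpredB ?filtproj_mem //.
exact: subvP (filt_le (leqnSn n)) _ (filtproj_mem n x).
Qed.

Lemma grproj_fpred n x : x \in fpred F n -> grproj n x = 0.
Proof.
case: n => [|n] /= Fx; first by move: Fx; rewrite memv0 => /eqP->; rewrite linear0.
rewrite sub_lfunE !filtproj_id ?subrr //.
exact: subvP (filt_le (leqnSn n)) _ Fx.
Qed.

Lemma grproj_lt m n x : (m < n)%N -> x \in F m -> grproj n x = 0.
Proof. by move=> lt_mn Fx; apply/grproj_fpred/(subvP (filt_fpred lt_mn)). Qed.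

Lemma sub_grproj n x : x \in F n -> x - grproj n x \in fpred F n.
Proof.
case: n => [|n] /= Fx; first by rewrite filtproj_id // subrr mem0v.
by rewrite sub_lfunE [filtproj n.+1 x]filtproj_id // subKr filtproj_mem.
Qed.

Lemma sum_grproj_filtproj n x : \sum_(i < n.+1) grproj i x = filtproj n x.
Proof.
elim: n => [|n IHn]; first by rewrite big_ord_recl big_ord0 addr0.
by rewrite big_ord_recr IHn /= sub_lfunE addrC subrK.
Qed.

Lemma sum_grproj x : \sum_(i < N.+1) grproj i x = x.
Proof. by rewrite sum_grproj_filtproj filtproj_id // F_N memvf. Qed.

(** If m > n, [grproj m] kills F_n, which contains the image of [grproj n]. If m < n, nestedness of
    the [filtproj] makes [grproj m] absorb [filtproj k] for all k >= m, and the two terms of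
    [grproj n] cancel. *)
Lemma grproj_ortho m n x : m != n -> grproj m (grproj n x) = 0.
Proof.
rewrite neq_ltn => /orP[lt_mn|lt_nm]; last exact: grproj_lt lt_nm (grproj_mem n x).
case: n lt_mn => // n lt_mn.
have PQ k : (m <= k)%N -> grproj m (filtproj k x) = grproj m x.
  case: m {lt_mn} => [|m] lt_mk /=; first exact: filtprojK.
  by rewrite !sub_lfunE !filtprojK // ltnW.
by rewrite sub_lfunE linearB /= !PQ ?subrr // ltnW.
Qed.

Lemma grproj_id n x : grproj n (grproj n x) = grproj n x.
Proof.
have [lt_nN|lt_Nn] := ltnP n N.+1; last first.
  by rewrite (grproj_lt lt_Nn (x := x)) ?linear0 // F_N memvf.
rewrite -[RHS]sum_grproj (bigD1 (Ordinal lt_nN)) //= big1 ?addr0 // => i ne_i.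
by rewrite grproj_ortho.
Qed.

Lemma grproj_filt0 (i : 'I_N.+1) x : x \in F 0%N ->
  grproj i x = if i == ord0 then x else 0.
Proof.
move=> F0x; case: eqP => [->|/eqP nz_i]; first exact: filtproj_id.
by apply: grproj_lt F0x; rewrite lt0n.
Qed.

Lemma grproj_mul i j k x y : (i + j < k)%N -> x \in F i -> y \in F j ->
  grproj k (hmul x y) = 0.
Proof. by move=> lt_k Fx Fy; apply: grproj_lt lt_k (filt_mul filtF Fx Fy). Qed.

(** The coproduct of [x] splits into pieces in the [tsub (F m) (F (n - m))], each spanned by pure
    tensors, so testing on those suffices. *)
Lemma tmap_filt_Delta (Z : vectType K) (f g : 'Hom(tprod H H, Z)) n x :
    (forall m, (m <= n)%N -> {in F m & F (n - m)%N, forall u w,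
       f (u ⊗ w) = g (u ⊗ w)}) ->
  x \in F n -> f (hDelta H x) = g (hDelta H x).
Proof.
move=> efg Fx; have /memv_sumP[s Fs ->] :
    hDelta H x \in (\sum_(m < n.+1) tsub (F m) (F (n - m)%N))%VS.
  by apply: subvP (filt_Delta filtF n) _ _; rewrite memv_img.
rewrite !linear_sum; apply: eq_bigr => m _.
by apply: tsub_ext (Fs m isT); apply: efg; rewrite -ltnS.
Qed.

(** For every m, either m < i or n - m < j, so on the tensors of F_m with F_(n-m) one of the two
    projections vanishes. *)
Lemma tmap_grproj_Delta i j n x : (n < i + j)%N -> x \in F n ->
  tmap (grproj i) (grproj j) (hDelta H x) = 0.
Proof.
move=> lt_n Fx; rewrite -[RHS](zero_lfunE _ (hDelta H x)).
apply: tmap_filt_Delta Fx => m le_mn u w Fu Fw; rewrite zero_lfunE tmapE.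
have [lt_mi|le_im] := ltnP m i.
  by rewrite (grproj_lt lt_mi Fu); apply/matrixP => k l; rewrite !mxE linear0 mul0r.
rewrite (@grproj_lt (n - m) j) //; last by lia.
by apply/matrixP => k l; rewrite !mxE linear0 mulr0.
Qed.

(* The structure transported along rescale t below, for t != 0.  The          *)
(* truncated exponents are harmless: the terms where they are not genuine     *)
(* differences vanish.                                                        *)
Definition deform (t : K) : hopf_ops H := HopfOps
  (\sum_(i < N.+1) \sum_(j < N.+1) \sum_(k < N.+1) t ^+ (i + j - k) *:
     (grproj k \o mu (hops H) \o tmap (grproj i) (grproj j))%VF)
  (\sum_(n < N.+1) \sum_(i < N.+1) \sum_(j < N.+1) t ^+ (n - (i + j)) *:
     (tmap (grproj i) (grproj j) \o hDelta H \o grproj n)%VF)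
  (\sum_(n < N.+1) t ^+ n *: (eps (hops H) \o grproj n)%VF).

(** For t != 0 this is [S] conjugated by [rescale t]; the terms with k > n vanish because [S]
    preserves the filtration. *)
Definition deform_antipode (t : K) : 'End(H) :=
  \sum_(n < N.+1) \sum_(k < N.+1) t ^+ (n - k) *: (grproj k \o S \o grproj n)%VF.

Definition deform_hopf t := HopfData (hone H) (deform t).

(** At t = 0 this is [grproj 0], in general not invertible; hence the limit structure comes from the
    formulas of [deform] and not from [pull]. *)
Definition rescale (t : K) : 'End(H) := \sum_(n < N.+1) t ^+ n *: grproj n.

Lemma rescaleE t x : rescale t x = \sum_(n < N.+1) t ^+ n *: grproj n x.
Proof. by rewrite sum_lfunE; apply: eq_bigr => n _; rewrite scale_lfunE. Qed.

Lemma rescale_grproj t (n : 'I_N.+1) x : rescale t (grproj n x) = t ^+ n *: grproj n x.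
Proof.
rewrite rescaleE (bigD1 n) //= grproj_id big1 ?addr0 // => i ne_in.
by rewrite grproj_ortho ?scaler0.
Qed.

Lemma rescaleK t t' : t' * t = 1 -> cancel (rescale t) (rescale t').
Proof.
move=> tt' x; rewrite [rescale t x]rescaleE linear_sum -[RHS]sum_grproj.
apply: eq_bigr => i _.
by rewrite linearZ /= rescale_grproj scalerA mulrC -exprMn tt' expr1n scale1r.
Qed.

Lemma deform_mulE t x y : @hmul _ (deform_hopf t) x y =
  \sum_(i < N.+1) \sum_(j < N.+1) \sum_(k < N.+1) t ^+ (i + j - k) *:
    grproj k (hmul (grproj i x) (grproj j y)).
Proof.
rewrite /hmul /= sum_lfunE; apply: eq_bigr => i _; rewrite sum_lfunE.
apply: eq_bigr => j _; rewrite sum_lfunE; apply: eq_bigr => k _.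
by rewrite scale_lfunE !comp_lfunE tmapE.
Qed.

Lemma deform_DeltaE t x : hDelta (deform_hopf t) x =
  \sum_(n < N.+1) \sum_(i < N.+1) \sum_(j < N.+1) t ^+ (n - (i + j)) *:
    tmap (grproj i) (grproj j) (hDelta H (grproj n x)).
Proof.
rewrite /hDelta /= sum_lfunE; apply: eq_bigr => i _; rewrite sum_lfunE.
apply: eq_bigr => j _; rewrite sum_lfunE; apply: eq_bigr => k _.
by rewrite scale_lfunE !comp_lfunE.
Qed.

Lemma deform_epsE t x : @heps _ (deform_hopf t) x =
  \sum_(n < N.+1) t ^+ n * heps (grproj n x).
Proof.
by rewrite /heps /= sum_lfunE; apply: eq_bigr => i _; rewrite scale_lfunE comp_lfunE.
Qed.

Lemma sum_tmap_grproj s :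
  \sum_(i < N.+1) \sum_(j < N.+1) tmap (grproj i) (grproj j) s = s.
Proof.
pose T := (\sum_(i < N.+1) \sum_(j < N.+1) tmap (grproj i) (grproj j))%R.
have -> : \sum_(i < N.+1) \sum_(j < N.+1) tmap (grproj i) (grproj j) s = T s.
  by rewrite sum_lfunE; apply: eq_bigr => i _; rewrite sum_lfunE.
rewrite -[RHS]id_lfunE; congr (fun_of_lfun _ s); apply: tprod_hom_ext => u w.
rewrite id_lfunE -[in RHS](sum_grproj u) -[in RHS](sum_grproj w).
have sum1 x : \sum_(i < N.+1) grproj i x = \sum_(i < N.+1) 1 *: grproj i x.
  by apply: eq_bigr => i _; rewrite scale1r.
rewrite !sum1 bilin_sum; [|exact: tensDr|exact: tensDl].
rewrite sum_lfunE; apply: eq_bigr => i _; rewrite sum_lfunE.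
by apply: eq_bigr => j _; rewrite tmapE mulr1 scale1r.
Qed.

(** For the product, t^(i+j-k) t^k = t^i t^j when k <= i + j, while the components with k > i + j
    vanish by the filtration. The coproduct is treated alike, with t^(n-(i+j)). *)
Lemma rescale_iso t : t != 0 -> @hopf_iso _ (deform_hopf t) H (rescale t).
Proof.
move=> nz_t; have [||V1 V2] := @cancel_lfunV _ _ _ (rescale t) (rescale t^-1).
- by apply: rescaleK; rewrite mulVf.
- by apply: rescaleK; rewrite mulfV.
split=> // [|x y|x|x].
- rewrite rescaleE (bigD1 ord0) //= filtproj_id ?(filt_one filtF) // expr0 scale1r.
  rewrite big1 ?addr0 // => i nz_i.
  by rewrite (grproj_filt0 _ (filt_one filtF)) (negPf nz_i) scaler0.
- rewrite deform_mulE (rescaleE t x) (rescaleE t y) bilin_sum; [|exact: hmulDr|exact: hmulDl].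
  rewrite linear_sum; apply: eq_bigr => i _; rewrite linear_sum.
  apply: eq_bigr => j _; rewrite -[in RHS](sum_grproj (hmul _ _)) scaler_sumr linear_sum.
  apply: eq_bigr => k _; rewrite linearZ /= rescale_grproj scalerA -!exprD.
  have [le_k|lt_k] := leqP k (i + j); first by rewrite subnK.
  by rewrite (grproj_mul lt_k) ?scaler0 ?grproj_mem.
- have tDP i : (rescale t \o grproj (i : 'I_N.+1) = t ^+ i *: grproj i)%VF.
    by apply/lfunP => y; rewrite comp_lfunE scale_lfunE rescale_grproj.
  rewrite deform_DeltaE rescaleE !linear_sum; apply: eq_bigr => n _.
  rewrite linearZ /= -[in RHS](sum_tmap_grproj (hDelta H _)) scaler_sumr linear_sum.
  apply: eq_bigr => i _; rewrite scaler_sumr linear_sum; apply: eq_bigr => j _.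
  rewrite linearZ /= tmap_comp !tDP tmapZ scalerA -!exprD.
  have [le_n|lt_n] := leqP (i + j) n; first by rewrite subnK.
  by rewrite (tmap_grproj_Delta lt_n) ?scaler0 ?grproj_mem.
- rewrite deform_epsE rescaleE {1}/heps linear_sum; apply: eq_bigr => n _.
  by rewrite linearZ.
Qed.

Lemma rescale_antipode t x : rescale t (deform_antipode t x) = S (rescale t x).
Proof.
have -> : deform_antipode t x = \sum_(n < N.+1) \sum_(k < N.+1)
    t ^+ (n - k) *: grproj k (S (grproj n x)).
  rewrite sum_lfunE; apply: eq_bigr => n _; rewrite sum_lfunE.
  by apply: eq_bigr => k _; rewrite scale_lfunE !comp_lfunE.
rewrite (rescaleE t x) !linear_sum; apply: eq_bigr => n _.
rewrite linear_sum linearZ /= -[in RHS](sum_grproj (S _)) scaler_sumr.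
apply: eq_bigr => k _; rewrite linearZ /= rescale_grproj scalerA -exprD.
have [le_k|lt_k] := leqP k n; first by rewrite subnK.
rewrite (grproj_lt lt_k) ?scaler0 //.
by apply: subvP (filt_S filtF n) _ _; rewrite memv_img ?grproj_mem.
Qed.

Lemma polyfam_deform :
  [/\ polyfam (fun t => mu (deform t)), polyfam (fun t => Delta (deform t)),
      polyfam (fun t => eps (deform t)) & polyfam deform_antipode].
Proof.
split.
- by do 3![apply: polyfam_sum => ?]; apply: polyfam_monomial.
- by do 3![apply: polyfam_sum => ?]; apply: polyfam_monomial.
- by apply: polyfam_sum => ?; apply: polyfam_monomial.
- by do 2![apply: polyfam_sum => ?]; apply: polyfam_monomial.
Qed.

Lemma deform0_hopf_algebra : [pchar K] =i pred0 -> bialgebra H -> antipode S ->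
  hopf_algebra (deform_hopf 0).
Proof.
move=> charK biH aS; have [pmu pD pe pS] := polyfam_deform; split.
  apply: limit_bialgebra => // t nz_t.
  exact: hopf_iso_bialgebra (rescale_iso nz_t) biH.
exists (deform_antipode 0); apply: limit_antipode => // t nz_t.
apply: (@hopf_iso_antipode _ (deform_hopf t) H _ (rescale_iso nz_t) _ S _ aS) => x.
exact: rescale_antipode.
Qed.

End GradedProjections.

(** * Identification of the limit with the graded Hopf algebra *)

Section GradedIso.
Variables (K : fieldType) (H : hopf_data K) (S : 'End(H)).
Variable F : nat -> {vspace H}.
Hypothesis filtF : hopf_filtration S F.
Variable N : nat.
Hypothesis F_N : F N = fullv.

Local Notation P := (grproj F N).
Local Notation grN := (gr_space F N).
Local Notation cls := (gr_class F N).
Local Notation H0 := (deform_hopf F N 0).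

(** The truncated exponent i + j - k is 0 exactly for k >= i + j, and the terms with k > i + j
    vanish by the filtration, so only k = i + j survives at t = 0. *)
Lemma deform0_mulE x y : @hmul _ H0 x y =
  \sum_(i < N.+1) \sum_(j < N.+1) P (i + j) (hmul (P i x) (P j y)).
Proof.
rewrite deform_mulE; apply: eq_bigr => i _; apply: eq_bigr => j _.
set z := hmul _ _; have Fz : z \in F (i + j)%N.
  by apply: (filt_mul filtF); apply: (grproj_mem filtF F_N).
have vanish (k : 'I_N.+1) : k != (i + j)%N :> nat ->
    (0 : K) ^+ (i + j - k) *: P k z = 0.
  rewrite neq_ltn => /orP[lt_k|lt_k]; last first.
    by rewrite (grproj_lt filtF F_N lt_k Fz) scaler0.
  by rewrite expr0n subn_eq0 leqNgt lt_k scale0r.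
have [lt_ij|lt_ij] := ltnP (i + j) N.+1.
  rewrite (bigD1 (Ordinal lt_ij)) //= subnn expr0 scale1r big1 ?addr0 //.
(* Here i + j > N: no k reaches i + j, and [P (i + j)] is 0, so both sides vanish. *)
rewrite (grproj_lt filtF F_N lt_ij) ?F_N ?memvf //.
by apply: big1 => k _; apply: vanish; rewrite neq_ltn (leq_trans (ltn_ord k) lt_ij).
Qed.

(** Only the terms with i + j = n survive at t = 0, so the double sum over i and j collapses to i =
    m, j = n - m. *)
Lemma deform0_DeltaE x : hDelta H0 x =
  \sum_(n < N.+1) \sum_(m < n.+1) tmap (P m) (P (n - m)) (hDelta H (P n x)).
Proof.
rewrite deform_DeltaE; apply: eq_bigr => n _.
set y := P n x; have Fy : y \in F n by apply: (grproj_mem filtF F_N).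
have vanish i j : (i + j)%N != n ->
    (0 : K) ^+ (n - (i + j)) *: tmap (P i) (P j) (hDelta H y) = 0.
  rewrite neq_ltn => /orP[lt_n|lt_n]; last first.
    by rewrite (tmap_grproj_Delta filtF F_N lt_n Fy) scaler0.
  by rewrite expr0n subn_eq0 leqNgt lt_n scale0r.
rewrite [RHS](big_ord_widen N.+1
  (fun m => tmap (P m) (P (n - m)) (hDelta H y)) (ltn_ord n)) [RHS]big_mkcond.
apply: eq_bigr => i _; rewrite ltnS; case: leqP => [le_in|lt_ni]; last first.
  by apply: big1 => j _; apply: vanish; rewrite neq_ltn ltn_addr ?orbT.
have lt_j : (n - i < N.+1)%N by apply: leq_ltn_trans (leq_subr i n) (ltn_ord n).
rewrite (bigD1 (Ordinal lt_j)) //= subnKC // subnn expr0 scale1r big1 ?addr0 // => j.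
rewrite /= -val_eqE => /= ne_j; apply: vanish; apply: contra ne_j => /eqP<-.
by rewrite addKn.
Qed.

Lemma deform0_epsE x : @heps _ H0 x = heps (P 0 x).
Proof.
rewrite deform_epsE (bigD1 ord0) //= expr0 mul1r big1 ?addr0 // => i nz_i.
by rewrite expr0n -[(i : nat) == 0%N]/(i == ord0) (negPf nz_i) mul0r.
Qed.

Lemma gr_repr_mem (a : grN) n : gr_repr a n \in F n.
Proof. exact: subvsP. Qed.

Lemma vpi_vsproj (n : 'I_N.+1) (u v : subvs_of (F n)) :
  (vpi _ u == vpi _ v :> gr_piece F n) = (vsval u - vsval v \in fpred F n).
Proof. by rewrite vpi_eq -memv_preim lfunE. Qed.

Lemma sub_gr_repr (a : grN) (n : 'I_N.+1) x : x \in F n ->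
  proj a n = vpi _ (vsproj (F n) x) -> gr_repr a n - x \in fpred F n.
Proof.
move=> Fx pa; rewrite -(vsprojK Fx) -vpi_vsproj.
by rewrite vpi_repr pa.
Qed.

Lemma projD (a b : grN) k n : proj (k *: a + b) n = k *: proj a n + proj b n.
Proof. by rewrite projE projE. Qed.

Lemma gr_class_linear n : linear (cls n).
Proof.
move=> k x y; apply: dirsumP => m; rewrite projD !projE.
by case: eqP => _; rewrite ?scaler0 ?addr0 // !linearP.
Qed.

Lemma gr_class_fpred n x : x \in fpred F n -> cls n x = 0.
Proof.
move=> Fx; apply: dirsumP => m; rewrite !projE; case: eqP => // emn.
apply/eqP; rewrite -[0 : gr_piece F m](linear0 (@vpi _ _ _)) vpi_vsproj.
rewrite [vsval 0]linear0 subr0 vsprojK emn //.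
exact: subvP (fpred_sub filtF n) _ Fx.
Qed.

Lemma gr_class_grproj n x : x \in F n -> cls n (P n x) = cls n x.
Proof.
move=> Fx; apply/eqP; rewrite eq_sym -subr_eq0 -!(linfun_linear (gr_class_linear n)).
rewrite -linearB /= linfun_linear; last exact: gr_class_linear.
by apply/eqP/gr_class_fpred/(sub_grproj filtF F_N).
Qed.

Lemma gr_class_gt n x : (N < n)%N -> cls n x = 0.
Proof.
move=> lt_Nn; apply: dirsumP => m; rewrite !projE; case: eqP => // emn.
by move: lt_Nn; rewrite -emn ltnNge -ltnS ltn_ord.
Qed.

Lemma proj_sum_class (x : 'I_N.+1 -> H) n :
  proj (\sum_(m < N.+1) cls m (x m)) n = vpi _ (vsproj (F n) (x n)).
Proof.
have projS m (f : 'I_m -> grN) :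
    proj (\sum_(i < m) f i) n = \sum_(i < m) proj (f i) n.
  elim: m f => [|m IHm] f; first by rewrite !big_ord0 projE.
  by rewrite !big_ord_recl -IHm projE.
rewrite projS (bigD1 n) //= big1 => [|m ne_mn]; last first.
  by rewrite projE eq_sym -[_ == _ :> nat]/(m == n) (negPf ne_mn).
by rewrite addr0 projE eqxx.
Qed.

Lemma sum_gr_class_repr (a : grN) : \sum_(n < N.+1) cls n (gr_repr a n) = a.
Proof.
apply: dirsumP => n; rewrite (proj_sum_class (gr_repr a)).
by rewrite vsvalK vpi_repr.
Qed.

(** [P n] kills H_(n-1), so the result does not depend on the representatives. Together with [grade]
    this identifies each H_n/H_(n-1) with the image of [P n]. *)
Definition ungrade (a : grN) : H := \sum_(n < N.+1) P n (gr_repr a n).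

Definition grade (x : H) : grN := \sum_(n < N.+1) cls n (P n x).

(** Choosing representatives is not linear, but the defect in degree n lies in [fpred F n], which
    [P n] kills. *)
Lemma ungrade_linear : linear ungrade.
Proof.
move=> k a b; rewrite /ungrade scaler_sumr -big_split; apply: eq_bigr => n _ /=.
rewrite -linearP; apply/eqP; rewrite -subr_eq0 -linearB /=; apply/eqP.
apply: (grproj_fpred filtF F_N); apply: sub_gr_repr.
  by rewrite memvD ?memvZ ?gr_repr_mem.
by rewrite projD -[in LHS](vpi_repr (proj a n)) -[in LHS](vpi_repr (proj b n))
   -linearP /=; congr vpi; rewrite -linearP vsvalK.
Qed.

Lemma grade_linear : linear grade.
Proof.
move=> k x y; rewrite /grade scaler_sumr -big_split; apply: eq_bigr => n _ /=.
by rewrite linearP gr_class_linear.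
Qed.

Lemma grproj_ungrade a (n : 'I_N.+1) : P n (ungrade a) = P n (gr_repr a n).
Proof.
rewrite linear_sum (bigD1 n) //= (grproj_id filtF F_N) big1 ?addr0 // => m ne_mn.
by rewrite (grproj_ortho filtF F_N) // eq_sym.
Qed.

Lemma ungradeK : cancel ungrade grade.
Proof.
move=> a; rewrite -[RHS]sum_gr_class_repr; apply: eq_bigr => n _.
by rewrite grproj_ungrade gr_class_grproj ?gr_repr_mem.
Qed.

Lemma grade_grproj n x : grade (P n x) = cls n (P n x).
Proof.
have [lt_nN|lt_Nn] := ltnP n N.+1; last first.
  have -> : P n x = 0 by rewrite (grproj_lt filtF F_N lt_Nn) // F_N memvf.
  by rewrite -!(linfun_linear grade_linear) gr_class_gt // linear0.
rewrite /grade (bigD1 (Ordinal lt_nN)) //= (grproj_id filtF F_N) big1 ?addr0 // => m.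
rewrite /= -val_eqE /= => ne_mn; rewrite (grproj_ortho filtF F_N) //.
by rewrite gr_class_fpred ?mem0v.
Qed.

Lemma gradeK : cancel grade ungrade.
Proof.
move=> x; rewrite -[RHS](sum_grproj filtF F_N) /ungrade; apply: eq_bigr => n _.
rewrite -[in RHS](grproj_id filtF F_N); apply/eqP; rewrite -subr_eq0 -linearB.
apply/eqP/(grproj_fpred filtF F_N)/sub_gr_repr; first exact: (grproj_mem filtF F_N).
exact: (proj_sum_class (fun m => P m x)).
Qed.

Lemma ungradeE a : linfun ungrade a = ungrade a.
Proof. exact: linfun_linear ungrade_linear a. Qed.

Lemma gradeE x : linfun grade x = grade x.
Proof. exact: linfun_linear grade_linear x. Qed.

Lemma gr_classE n x : linfun (cls n) x = cls n x.
Proof. exact: linfun_linear (gr_class_linear n) x. Qed.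

Lemma gr_class_eq n x y : x - y \in fpred F n -> cls n x = cls n y.
Proof.
move=> Fxy; apply/eqP; rewrite -subr_eq0 -!gr_classE -linearB /= gr_classE.
by rewrite gr_class_fpred.
Qed.

Lemma fpred_mull i j x y : x \in fpred F i -> y \in F j ->
  hmul x y \in fpred F (i + j).
Proof.
case: i => [|i] /= Fx Fy; last exact: filt_mul filtF _ _ _ _ Fx Fy.
move: Fx; rewrite memv0 => /eqP->.
by rewrite -[hmul _ _](linfun_linear (hmulDl y)) linear0 mem0v.
Qed.

Lemma fpred_mulr i j x y : x \in F i -> y \in fpred F j ->
  hmul x y \in fpred F (i + j).
Proof.
case: j => [|j] /= Fx Fy; last by rewrite addnS; exact: filt_mul filtF _ _ _ _ Fx Fy.
move: Fy; rewrite memv0 => /eqP->.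
by rewrite -[hmul _ _](linfun_linear (hmulDr x)) linear0 mem0v.
Qed.

(** [gr_mu] lifts a formula on chosen representatives; that formula is first identified with the
    bilinear [B], after which [tliftE] applies. *)
Lemma gr_mulE (a b : grN) : gr_mu F N (a ⊗ b) =
  grade (@hmul _ H0 (ungrade a) (ungrade b)).
Proof.
pose B (a b : grN) := linfun grade (@hmul _ H0 (ungrade a) (ungrade b)).
have -> : gr_mu F N (a ⊗ b) = tlift B (a ⊗ b).
  apply: eq_tlift => {}a {}b; rewrite /B deform0_mulE linear_sum.
  apply: eq_bigr => i _; rewrite linear_sum; apply: eq_bigr => j _.
  rewrite /= gradeE grade_grproj !grproj_ungrade gr_class_grproj; last first.
    by apply: (filt_mul filtF); apply: (grproj_mem filtF F_N).
  apply: gr_class_eq; set x := gr_repr a i; set y := gr_repr b j.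
  have Fx : x \in F i := gr_repr_mem a i.
  have Fy : y \in F j := gr_repr_mem b j.
  (* Replacing one factor at a time, each error term has a factor of lower filtration degree, so it
     lies in H_(i+j-1). *)
  have -> : hmul x y - hmul (P i x) (P j y) =
      hmul (x - P i x) y + hmul (P i x) (y - P j y).
    rewrite -![hmul _ y](linfun_linear (hmulDl y)) linearB /=.
    rewrite -[hmul _ (y - _)](linfun_linear (hmulDr (P i x))) linearB /=.
    by rewrite !(linfun_linear (hmulDr _)) !(linfun_linear (hmulDl _)) addrA subrK.
  apply: memvD; first exact: (fpred_mull (sub_grproj filtF F_N Fx) Fy).
  exact: (fpred_mulr (grproj_mem filtF F_N i x) (sub_grproj filtF F_N Fy)).
rewrite tliftE; first by rewrite /B gradeE.
  move=> x k u v; rewrite /B ungrade_linear.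
  by rewrite (hmulDr (A := H0)) linearP.
move=> y k u v; rewrite /B ungrade_linear.
by rewrite (hmulDl (A := H0)) linearP.
Qed.

Lemma tmap_grproj_Delta_fpred i j n x : (n <= i + j)%N -> x \in fpred F n ->
  tmap (P i) (P j) (hDelta H x) = 0.
Proof.
case: n => [|n] /= le_n Fx; last exact: (tmap_grproj_Delta filtF F_N le_n Fx).
by move: Fx; rewrite memv0 => /eqP->; rewrite !linear0.
Qed.

Lemma grade_grproj_filt m x : x \in F m -> linfun grade (P m x) = cls m x.
Proof. by move=> Fx; rewrite gradeE grade_grproj gr_class_grproj. Qed.

(** [tmap (P m) (P (n - m))] annihilates every piece of the decomposition of the coproduct except
    the m-th, so the choice made by [sumv_pi] does not affect the result. *)
Lemma gr_DeltaE a : gr_Delta F N a =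
  tmap (linfun grade) (linfun grade) (hDelta H0 (ungrade a)).
Proof.
(* [linfun G] evaluates to [G] once [G] is known to be linear; [GE] shows this by writing [G] as a
   composite of linear maps. *)
rewrite /gr_Delta; set G := (X in linfun X a = _); have GE b :
    G b = tmap (linfun grade) (linfun grade) (hDelta H0 (linfun ungrade b)).
  rewrite ungradeE deform0_DeltaE linear_sum; apply: eq_bigr => n _.
  rewrite grproj_ungrade linear_sum; set x := gr_repr b n.
  have Fx : x \in F n := gr_repr_mem b n.
  (* [x] and [P n x] differ by an element of H_(n-1), whose coproduct is killed since m + (n - m) =
     n. *)
  have DPx (m : 'I_n.+1) : tmap (P m) (P (n - m)) (hDelta H (P n x)) =
      tmap (P m) (P (n - m)) (hDelta H x).
    apply/eqP; rewrite eq_sym -subr_eq0 -!linearB /=; apply/eqP.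
    apply: (@tmap_grproj_Delta_fpred _ _ n); first by rewrite subnKC // -ltnS.
    exact: (sub_grproj filtF F_N).
  set pi := sumv_pi _.
  have pi_mem (m : 'I_n.+1) : pi m (hDelta H x) \in tsub (F m) (F (n - m)%N).
    exact: memv_sum_pi.
  have sum_pi : hDelta H x = \sum_(m < n.+1) pi m (hDelta H x).
    rewrite (sumv_pi_sum (erefl _)) //.
    by apply: subvP (filt_Delta filtF n) _ _; rewrite memv_img.
  apply: eq_bigr => m _; rewrite DPx {2}sum_pi !linear_sum (bigD1 m) //=.
  rewrite tmap_comp big1 ?addr0 => [|k ne_km].
    apply: tsub_ext (pi_mem m) => u w Fu Fw.
    by rewrite !tmapE !comp_lfunE !grade_grproj_filt // !gr_classE.
  rewrite -[RHS](zero_lfunE _ (pi k (hDelta H x))) tmap_comp.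
  apply: tsub_ext (pi_mem k) => u w Fu Fw.
  rewrite zero_lfunE tmapE !comp_lfunE; move: ne_km; rewrite -val_eqE neq_ltn.
  (* A piece with k < m dies in the left factor; one with k > m dies in the right factor, since then
     n - k < n - m. *)
  case/orP=> [lt_km|lt_mk].
    rewrite (grproj_lt filtF F_N lt_km Fu).
    by apply/matrixP => i j; rewrite !mxE !linear0 mul0r.
  rewrite (@grproj_lt _ _ _ _ filtF _ F_N (n - k) (n - m)) //.
    by apply/matrixP => i j; rewrite !mxE !linear0 mulr0.
  by move: lt_mk (ltn_ord k) => /=; lia.
rewrite linfun_linear; first by rewrite GE ungradeE.
by move=> k b c; rewrite !GE !linearP.
Qed.

Lemma gr_epsE a : gr_eps F N a = @heps _ H0 (ungrade a).
Proof.
have GE (b : grN) : (heps (gr_repr b ord0) : K^o) = eps (deform F N 0) (linfun ungrade b).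
  rewrite ungradeE -[RHS]/(@heps _ H0 _) deform0_epsE (grproj_ungrade b ord0).
  by rewrite [P 0 _](filtproj_id filtF F_N) // (gr_repr_mem b ord0).
rewrite /gr_eps linfun_linear; first by rewrite GE ungradeE.
by move=> k b c; rewrite !GE !linearP.
Qed.

Lemma ungrade_iso : @hopf_iso _ (gr_upto F N) H0 (linfun ungrade).
Proof.
have cUG : cancel (linfun ungrade) (linfun grade).
  by move=> a; rewrite gradeE ungradeE ungradeK.
have cGU : cancel (linfun grade) (linfun ungrade).
  by move=> x; rewrite gradeE ungradeE gradeK.
have [V1 V2] := cancel_lfunV cUG cGU; split=> // [|a b|a|a].
- have one_mem := filt_one filtF.
  rewrite /= -(gr_class_grproj one_mem) -grade_grproj -gradeE cGU.
  exact: (filtproj_id filtF F_N one_mem).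
- by rewrite -[hmul a b]/(gr_mu F N (a ⊗ b)) gr_mulE -gradeE cGU !ungradeE.
- rewrite -[hDelta _ a]/(gr_Delta F N a) gr_DeltaE (tmapK cGU cGU).
  by rewrite ungradeE.
- by rewrite -[heps a]/(gr_eps F N a) gr_epsE ungradeE.
Qed.

End GradedIso.

(** * Points of the variety of Hopf algebras *)

Section Points.
Variable K : fieldType.

Lemma dim_cancel (U W : vectType K) (f : 'Hom(U, W)) :
  cancel f f^-1%VF -> cancel f^-1%VF f -> \dim {:U} = \dim {:W}.
Proof.
move=> fK fVK; have ker0 : lker f == 0%VS by apply/lker0P/can_inj/fK.
rewrite -(limg_dim_eq (f := f)) ?(eqP ker0) ?capv0 //; congr (\dim _).
by apply/vspaceP => y; rewrite memvf -[y]fVK memv_img ?memvf.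
Qed.

(** The unit is nonzero because its counit is 1; the dimension can thus be written [d.+1]. *)
Lemma bialgebra_dim_gt0 (A : hopf_data K) : bialgebra A -> (0 < \dim {:A})%N.
Proof.
move=> biA; rewrite lt0n dimv_eq0; apply/eqP => full0.
have one0 : hone A = 0 by apply/eqP; rewrite -memv0 -full0 memvf.
have := heps1 biA; rewrite one0 /heps linear0 => /esym/eqP.
by rewrite oner_eq0.
Qed.

Definition basis_hom (V : vectType K) n (e : n.-tuple V) : 'Hom('rV[K]_n, V) :=
  linfun (fun v : 'rV[K]_n => \sum_i v 0 i *: tnth e i).

Lemma basis_homE (V : vectType K) n (e : n.-tuple V) v :
  basis_hom e v = \sum_i v 0 i *: tnth e i.
Proof.
rewrite /basis_hom linfun_linear // => a x y.
rewrite scaler_sumr -big_split; apply: eq_bigr => i _.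
by rewrite !mxE scalerDl scalerA.
Qed.

Lemma basis_hom_cancel (V : vectType K) n (e : n.-tuple V) :
    basis_of {:V} e ->
  cancel (basis_hom e) (basis_hom e)^-1%VF /\
  cancel (basis_hom e)^-1%VF (basis_hom e).
Proof.
move=> be; apply: (cancel_lfunV (g := fun x => \row_i coord e i x)).
  move=> v; apply/rowP => i; rewrite mxE basis_homE.
  rewrite (eq_bigr (fun i => v 0 i *: e`_i)) => [|j _]; last by rewrite (tnth_nth 0).
  by rewrite coord_sum_free // (basis_free be).
move=> x; rewrite basis_homE [RHS](coord_basis be (memvf x)).
by apply: eq_bigr => i _; rewrite mxE (tnth_nth 0).
Qed.

Lemma basis_hom_delta (V : vectType K) n (e : n.-tuple V) i :
  basis_hom e (delta_mx 0 i) = tnth e i.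
Proof.
rewrite basis_homE (bigD1 i) //= mxE !eqxx scale1r big1 ?addr0 // => j ne_ji.
by rewrite mxE (negPf ne_ji) andbF scale0r.
Qed.

Lemma hopf_point_iso (A : hopf_data K) d (e : d.+1.-tuple A) : unital_basis e ->
  @hopf_iso _ (HopfData (delta_mx 0 0 : 'rV[K]_d.+1) (hopf_point e)) A (basis_hom e).
Proof.
case=> be e0; have [eK eVK] := basis_hom_cancel be.
by apply: pull_hopf_iso => //; rewrite basis_hom_delta.
Qed.

(** With [f] fixed, structure constants depend linearly on the structure maps. *)
Lemma polyfam_sconst_pull (V : vectType K) n (f : 'Hom('rV[K]_n, V))
    (h : K -> hopf_ops V) s :
    polyfam (fun t => mu (h t)) -> polyfam (fun t => Delta (h t)) ->
    polyfam (fun t => eps (h t)) ->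
  polyfam (fun t => sconst (pull f (h t)) s : K^o).
Proof.
move=> pmu pD pe; case: s => [[[[i j] k]|[[i j] k]]|i].
- set v := tmap f f (delta_mx 0 i ⊗ delta_mx 0 j).
  apply: (@polyfam_eq _ K^o (fun t => f^-1%VF (mu (h t) v) 0 k)).
    by move=> t; rewrite ffunE /= !comp_lfunE.
  exact: polyfam_entry (polyfam_lin _ (polyfam_app pmu (polyfam_cst v))).
- set v := f (delta_mx 0 i).
  pose l := tlift (fun x y : 'rV[K]_n => (x 0 j * y 0 k : K^o)).
  apply: (@polyfam_eq _ K^o (fun t => l (tmap f^-1 f^-1 (Delta (h t) v)))).
    by move=> t; rewrite ffunE /= !comp_lfunE.
  exact: polyfam_lin _ (polyfam_lin _ (polyfam_app pD (polyfam_cst v))).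
- set v := f (delta_mx 0 i).
  apply: (@polyfam_eq _ K^o (fun t => eps (h t) v)).
    by move=> t; rewrite ffunE /= !comp_lfunE.
  exact: polyfam_app pe (polyfam_cst v).
Qed.

End Points.

Theorem theorem3p1 (K : closedFieldType) (charK : [pchar K] =i pred0)
    (H : hopf_data K) (S : 'End(H))
    (bialgH : bialgebra H) (antipS : antipode S)
    (F : nat -> {vspace H})
    (filtF : hopf_filtration S F) (exF : exhaustive F) :
  degeneration (gr filtF exF) H.
Proof.
rewrite /gr; set N := depth filtF exF.
have F_N : F N = fullv by apply/eqP; rewrite /N /depth; case: ex_minnP.
have iso_gr := ungrade_iso filtF F_N; set phi := linfun _ in iso_gr.
have hopfH0 := deform0_hopf_algebra filtF F_N charK bialgH antipS.
exists (\dim {:H}).-1.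
have dimH : \dim {:H} = (\dim {:H}).-1.+1 by rewrite prednK ?bialgebra_dim_gt0.
split=> //; first by rewrite -dimH; apply: dim_cancel (hiK iso_gr) (hiVK iso_gr).
move: (\dim {:H}).-1 => d e0 e ube0 ube.
have iso_e := hopf_point_iso ube; have iso_e0 := hopf_point_iso ube0.
have iso_Phi := hopf_iso_comp iso_e0 iso_gr.
set Phi := (phi \o _)%VF in iso_Phi.
(* The point of gr(H) is a Hopf algebra because the limit structure is one. *)
split; first exact: hopf_iso_algebra iso_Phi hopfH0.
(* A curve that is the chosen point of gr(H) at t = 0 and lies in the orbit of H for t != 0. *)
pose q t := pull Phi (deform F N t).
have iso_q t : @hopf_iso _ (HopfData (delta_mx 0 0 : 'rV[K]_d.+1) (q t))
    (deform_hopf F N t) Phi.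
  exact: (@pull_hopf_iso _ _ (deform_hopf F N t) Phi _ (hiK iso_Phi) (hiVK iso_Phi)
    (hi1 iso_Phi)).
have -> : hopf_point e0 = q 0 := hopf_iso_pull iso_Phi.
move=> P P0; have [pmu pD pe _] := polyfam_deform S F N.
(* Along the curve, [P] is a polynomial in t. *)
apply: (@polyfam_eq0 K K^o (fun t => P.@[fun i => sconst (q t) (enum_val i)]) charK).
  by apply: polyfam_meval => i; apply: polyfam_sconst_pull.
move=> t nz_t; apply: P0; exists (q t) => //.
have iso_qH := hopf_iso_comp (iso_q t) (rescale_iso filtF F_N nz_t).
split; first by apply: hopf_iso_algebra iso_qH _; split=> //; exists S.
have iso_f := hopf_iso_comp iso_qH (hopf_iso_inv iso_e).
(* [Phi] leads from coordinates through gr(H) to the deformed structure, [rescale] from there to H,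
   and the last map back to coordinates in the basis [e]. *)
exists ((basis_hom e)^-1 \o (rescale F N t \o Phi))%VF; split.
  exact/lker0P/can_inj/(hiK iso_f).
exact: hopf_iso_pull iso_f.
Qed.
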